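(* Let $f:\mathcal{G}\to\mathbb{R}^+$ and let $\{G_i\}_{i=1}^\infty$ be a sequence of finite graphs such that $\{A(G_i)/f(G_i)\}_{i=1}^\infty$ is an action convergent sequence of $P$-operators. Assume that there exist $p\in[1,\infty)$, $q\in(1,\infty)$ and $c\in\mathbb{R}^+$ such that $\|A(G_i)/f(G_i)\|_{p\to q}\le c$ for every $i$. Then there is a graphop $A$ such that $\lim_{i\to\infty}d_M(A(G_i)/f(G_i),A)=0$.
   Context: $\mathcal{G}$ is the set of isomorphism classes of finite graphs. For a graph $G$ on $[n]$, $A(G)$ is the $P$-operator on $([n],\text{uniform measure})$ given by $(vA(G))(i)=\sum_{(j,i)\in E(G)}v(j)$. A $P$-operator on a probability space $\Omega$ is a linear $A:L^\infty(\Omega)\to L^1(\Omega)$, $v\mapsto vA$, with $\|A\|_{\infty\to1}<\infty$; $\|A\|_{p\to q}=\sup_{v\in L^\infty}\|vA\|_q/\|v\|_p$. With $(f,g)_A=\int(fA)g$, $A$ is self-adjoint if $(v,w)_A=(w,v)_A$ for all $v,w$, positivity-preserving if $v\ge0$ a.e. implies $vA\ge0$ a.e.; a graphop is a self-adjoint positivity-preserving $P$-operator. $\mathcal{S}_k(A)$ is the set of joint distributions of $(v_1,\dots,v_k,v_1A,\dots,v_kA)$ over measurable $v_i:\Omega\to[-1,1]$; $d_M(A,B)=\sum_k2^{-k}d_H(\mathcal{S}_k(A),\mathcal{S}_k(B))$ with $d_H$ the Hausdorff distance induced by the Lévy–Prokhorov metric; action convergence means each $\{\mathcal{S}_k\}$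 is $d_H$-Cauchy. *)

(* Defs.v *)
From HB Require Import structures.
From mathcomp Require Import all_boot all_order all_algebra.
From mathcomp Require Import all_classical all_reals all_analysis.

Set Implicit Arguments.
Unset Strict Implicit.
Unset Printing Implicit Defensive.

Import Order.TTheory GRing.Theory Num.Theory.
Import numFieldTopology.Exports numFieldNormedType.Exports.
Local Open Scope classical_set_scope.
Local Open Scope ring_scope.

(* An operator is a map A : (T -> R) -> (T -> R), v |-> vA, of which only   *)
(* the restriction to L^oo(P) matters; it must be compatible with a.e.      *)
(* equality (so it is a map on equivalence classes L^oo -> L^1), linear     *)
(* (up to a.e. equality) and bounded from L^oo to L^1.                       *)
Section Poperators.
Context {d : measure_display} {T : measurableType d} {R : realType}.
Variable P : probability T R.

Definition Linf (v : T -> R) : Prop :=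
  measurable_fun setT v /\ exists M : R, \forall x \ae P, `|v x| <= M.

Definition Poperator (A : (T -> R) -> (T -> R)) : Prop :=
  [/\ (forall v, Linf v -> measurable_fun setT (A v)),
      (forall v w, Linf v -> Linf w ->
          (\forall x \ae P, v x = w x) -> \forall x \ae P, A v x = A w x),
      (forall (a b : R) v w, Linf v -> Linf w ->
          \forall x \ae P, A (fun y => a * v y + b * w y) x = a * A v x + b * A w x)
    & exists C : R, forall v, Linf v ->
          (Lnorm P 1%:E (EFin \o A v) <= C%:E * Lnorm P +oo%E (EFin \o v))%E].

Definition pairing (A : (T -> R) -> (T -> R)) (f g : T -> R) : \bar R :=
  (\int[P]_x (A f x * g x)%:E)%E.

Definition self_adjoint (A : (T -> R) -> (T -> R)) : Prop :=
  forall v w, Linf v -> Linf w -> pairing A v w = pairing A w v.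

Definition positivity_preserving (A : (T -> R) -> (T -> R)) : Prop :=
  forall v, Linf v -> (\forall x \ae P, 0 <= v x) -> \forall x \ae P, 0 <= A v x.

Definition graphop (A : (T -> R) -> (T -> R)) : Prop :=
  [/\ Poperator A, self_adjoint A & positivity_preserving A].

Definition pq_norm_le (A : (T -> R) -> (T -> R)) (p q c : \bar R) : Prop :=
  forall v, Linf v -> (Lnorm P q (EFin \o A v) <= c * Lnorm P p (EFin \o v))%E.

Definition law (m : nat) (X : T -> 'rV[R]_m) : set 'rV[R]_m -> \bar R :=
  fun U => P (X @^-1` U).

Definition Sk (A : (T -> R) -> (T -> R)) (k : nat) :
    set (set 'rV[R]_(k + k) -> \bar R) :=
  [set law (fun x => row_mx (\row_(j < k) v j x) (\row_(j < k) A (v j) x))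
  | v in [set v : 'I_k -> T -> R |
          forall j, measurable_fun setT (v j) /\ forall x, -1 <= v j x <= 1]].

End Poperators.

(* Distributions on R^m are represented by their values on (Borel) sets.     *)
Section Metrics.
Context {R : realType}.

Definition edist (m : nat) (x y : 'rV[R]_m) : R :=
  Num.sqrt (\sum_(i < m) (x ord0 i - y ord0 i) ^+ 2).

Definition eopen (m : nat) (O : set 'rV[R]_m) : Prop :=
  forall x, O x -> exists2 e : R, 0 < e & [set y | edist x y < e] `<=` O.

Definition borel (m : nat) : set (set 'rV[R]_m) := <<s [set O | eopen O] >>.

Definition enbhd (m : nat) (U : set 'rV[R]_m) (eps : R) : set 'rV[R]_m :=
  [set x | exists2 u, U u & edist x u < eps].

Definition dLP (m : nat) (mu nu : set 'rV[R]_m -> \bar R) : R :=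
  inf [set eps : R | 0 < eps /\
        forall U, borel U ->
          (mu U <= nu (enbhd U eps) + eps%:E)%E /\
          (nu U <= mu (enbhd U eps) + eps%:E)%E].

Definition dH (m : nat) (X Y : set (set 'rV[R]_m -> \bar R)) : R :=
  Num.max (sup [set inf [set dLP x y | y in Y] | x in X])
          (sup [set inf [set dLP x y | x in X] | y in Y]).

Definition dM (S1 S2 : forall k : nat, set (set 'rV[R]_(k + k) -> \bar R)) : R :=
  limn (series (fun k : nat => (2 ^- k.+1) * dH (S1 k.+1) (S2 k.+1)) : R^nat).

Definition action_convergent
    (S : nat -> forall k : nat, set (set 'rV[R]_(k + k) -> \bar R)) : Prop :=
  forall k : nat, (0 < k)%N ->
    forall eps : R, 0 < eps -> exists N : nat, forall i j : nat,
      (N <= i)%N -> (N <= j)%N -> dH (S i k) (S j k) < eps.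

End Metrics.

(* Finite graphs.  A graph with vertex set [n] (n >= 1) is represented on   *)
(* 'I_n'.+1 with n = n'.+1; the probability space is [n] with the uniform   *)
(* measure (discrete sigma-algebra).                                        *)
Definition vert (n' : nat) : Type := 'I_n'.+1.
HB.instance Definition _ n' := Finite.copy (vert n') 'I_n'.+1.
HB.instance Definition _ n' := isPointed.Build (vert n') ord0.
HB.instance Definition _ (n' : nat) := @isMeasurable.Build default_measure_display
  (vert n') discrete_measurable discrete_measurable0
  discrete_measurableC discrete_measurableU.

Definition unif (R : realType) (n' : nat) : probability (vert n') R :=
  mnormalize (@counting (vert n') R) (dirac (ord0 : vert n')).

Record sgraph (n' : nat) := SGraph {
  adj : rel (vert n');
  adj_sym : symmetric adj;
  adj_irr : irreflexive adj }.

Definition gisom (n' : nat) (G G' : sgraph n') : Prop :=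
  exists s : vert n' -> vert n', bijective s /\ forall x y, adj G' (s x) (s y) = adj G x y.

Definition graph_op (R : realType) (n' : nat) (G : sgraph n')
    (v : vert n' -> R) : vert n' -> R :=
  fun i => \sum_(j | adj G j i) v j.

(* Main.v *)
Require Import Defs.
From HB Require Import structures.
From mathcomp Require Import all_boot all_order all_algebra.
From mathcomp Require Import all_classical all_reals all_analysis.
From mathcomp Require Import measurable_realfun ess_sup_inf.
From mathcomp Require Import ring lra.

(** The limit operator lives on the ultraproduct of the vertex sets. Fix a
    nonprincipal ultrafilter on nat. Ultralimits of the uniform measures on
    internal sets extend, by countable saturation, to a probability (the Loeb
    measure) on the sets that differ from an internal set by a null set. Every
    bounded measurable v on this space is a.e. the ultralimit of uniformly
    bounded v_i on the vertex sets, and v A is defined as the ultralimit of the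
    v_i A_i. The bound on the q-norm of the degree functions 1 A_i, with q > 1,
    makes them uniformly integrable; since |v_i A_i| <= M (1 A_i) when
    |v_i| <= M, and since the mean of |v_i A_i| is at most the mean of
    |v_i| (1 A_i) by symmetry, the ultralimits exist a.e., do not depend on the
    choice of the v_i, and commute with integration. Hence A is a graphop. An
    element of S_k(A) is the law of an ultralimit of random vectors whose laws
    are in the S_k(A_i), and every ultralimit of such vectors arises in this
    way, so the Cauchy condition bounds d_H(S_k(A_i), S_k(A)). *)

Set Implicit Arguments.
Unset Strict Implicit.
Unset Printing Implicit Defensive.
Import Order.TTheory GRing.Theory Num.Theory.
Import numFieldTopology.Exports numFieldNormedType.Exports.
Local Open Scope classical_set_scope.
Local Open Scope ring_scope.

(** * Ultralimits and uniform averages *)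

Lemma exists_nat_ultra : exists U : set_system nat, UltraFilter U /\ \oo `<=` U.
Proof. exact: ultraFilterLemma. Qed.

Definition nat_ultra : set_system nat := sval (cid exists_nat_ultra).

Instance nat_ultra_ultra : UltraFilter nat_ultra.
Proof. exact: (svalP (cid exists_nat_ultra)).1. Qed.

Instance nat_ultra_proper : ProperFilter nat_ultra.
Proof. exact: ultra_proper. Qed.

Lemma near_ultra (P : nat -> Prop) :
  (\forall i \near \oo, P i) -> \forall i \near nat_ultra, P i.
Proof. exact: (svalP (cid exists_nat_ultra)).2. Qed.

Lemma near_ultra_ge n : \forall i \near nat_ultra, (n <= i)%N.
Proof. by apply: near_ultra; exists n. Qed.

Lemma ultraN (P : nat -> Prop) : ~ (\forall i \near nat_ultra, P i) ->
  \forall i \near nat_ultra, ~ P i.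
Proof. by case: (in_ultra_setVsetC P nat_ultra_ultra). Qed.

Lemma ultra_map (T : Type) (x : nat -> T) : UltraFilter (x @ nat_ultra).
Proof.
split=> [|G GP xG]; first exact: fmap_proper_filter.
apply/seteqP; split=> // A GA.
have [//|xA] := in_ultra_setVsetC (x @^-1` A) nat_ultra_ultra.
by have [y []] := filter_ex (filterI GA (xG (~` A) xA)).
Qed.

Section ultralimits.
Variable R : realType.
Implicit Types (x y : nat -> R) (K : R).

(** An ultrafilter on a compact segment converges; this replaces every extraction of
    subsequences. *)
Lemma bounded_ultra_cvg K x : (\forall i \near nat_ultra, `|x i| <= K) ->
  cvg (x @ nat_ultra).
Proof.
move=> xK; have := @segment_compact R (- K) K; rewrite compact_ultra.
move=> /(_ (x @ nat_ultra) (ultra_map x)) [].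
  by apply: filterS xK => i; rewrite /= in_itv /= ler_norml.
by move=> l [_ xl]; apply/cvg_ex; exists l.
Qed.

Lemma ultra_cvg_squeeze0 x : (forall e, 0 < e -> \forall i \near nat_ultra, `|x i| <= e) ->
  x @ nat_ultra --> (0 : R).
Proof.
move=> x0; apply/cvgr0Pnorm_lt => e e0.
have e20 : 0 < e / 2 by rewrite divr_gt0.
apply: filterS (x0 _ e20) => i /le_lt_trans; apply; lra.
Qed.

Lemma ultra_le_lim x y a b : x @ nat_ultra --> a -> y @ nat_ultra --> b ->
  (\forall i \near nat_ultra, x i <= y i) -> a <= b.
Proof.
move=> xa yb xy; rewrite -subr_ge0; apply: (cvgr_to_ge (cvgB yb xa)).
by apply: filterS xy => i; rewrite subr_ge0.
Qed.

Lemma exists_natSinv_lt (e : R) : 0 < e -> exists n, n.+1%:R^-1 < e.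
Proof.
move=> e0; have [n _ /(_ n (leqnn n)) ne] := near_infty_natSinv_lt (PosNum e0).
by exists n.
Qed.

End ultralimits.

(** * Averages and probabilities on a finite vertex set *)

Section averages.
Variables (R : realType) (n : nat).
Implicit Types (g h : vert n -> R) (A B : set (vert n)).

Definition avg g : R := (\sum_x g x) / n.+1%:R.

Lemma ler_avg g h : (forall x, g x <= h x) -> avg g <= avg h.
Proof. by move=> gh; rewrite ler_wpM2r// ler_sum. Qed.

Lemma avgD g h : avg (fun x => g x + h x) = avg g + avg h.
Proof. by rewrite /avg big_split mulrDl. Qed.

Lemma avgZ k g : avg (fun x => k * g x) = k * avg g.
Proof. by rewrite /avg -mulr_sumr mulrA. Qed.

Lemma avgB g h : avg (fun x => g x - h x) = avg g - avg h.
Proof. by rewrite /avg sumrB mulrBl. Qed.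

Lemma avg_cst k : avg (fun=> k) = k.
Proof.
by rewrite /avg sumr_const card_ord -[k *+ _]mulr_natr mulfK// pnatr_eq0.
Qed.

Lemma avg_sum (I : Type) (r : seq I) (G : I -> vert n -> R) :
  avg (fun x => \sum_(i <- r) G i x) = \sum_(i <- r) avg (G i).
Proof. by rewrite /avg exchange_big mulr_suml. Qed.

Lemma avg_ge0 g : (forall x, 0 <= g x) -> 0 <= avg g.
Proof. by move=> /ler_avg; rewrite avg_cst. Qed.

Lemma ler_norm_avg g : `|avg g| <= avg (fun x => `|g x|).
Proof.
by rewrite /avg normrM [`|_^-1|]ger0_norm// ler_wpM2r// ler_norm_sum.
Qed.

Definition pr A : R := avg (\1_A).

Lemma pr0 : pr set0 = 0.
Proof. by rewrite /pr indic0 avg_cst. Qed.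

Lemma prT : pr setT = 1.
Proof. by rewrite /pr indicT avg_cst. Qed.

Lemma le_pr A B : A `<=` B -> pr A <= pr B.
Proof.
move=> AB; apply: ler_avg => x; rewrite !indicE ler_nat.
by have [xA|] := boolP (x \in A); rewrite ?leq0n// mem_set//; apply/AB/set_mem.
Qed.

Lemma pr_ge0 A : 0 <= pr A.
Proof. by rewrite -pr0 le_pr. Qed.

Lemma pr_le1 A : pr A <= 1.
Proof. by rewrite -prT le_pr. Qed.

Lemma prUI A B : pr (A `|` B) + pr (A `&` B) = pr A + pr B.
Proof.
rewrite -!avgD; congr avg; apply/funext => x.
rewrite !indicE in_setU in_setI -!natrD.
by case: (x \in A); case: (x \in B).
Qed.

Lemma prDI A B : pr (A `\` B) + pr (A `&` B) = pr A.
Proof.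
rewrite -avgD; congr avg; apply/funext => x.
rewrite !indicE in_setD in_setI -!natrD.
by case: (x \in A); case: (x \in B).
Qed.

Lemma pr_markov g t : (forall x, 0 <= g x) -> t * pr [set x | t <= g x] <= avg g.
Proof.
move=> g0; rewrite -avgZ; apply: ler_avg => x; rewrite indicE.
have [/set_mem /= tg|_] := boolP (x \in _); first by rewrite mulr1.
by rewrite mulr0.
Qed.

Lemma unifE A : unif R n A = (pr A)%:E.
Proof.
have cE B : (counting B = (\sum_x (\1_B x : R))%:E)%E.
  rewrite /counting asboolT; last exact: finite_finset.
  rewrite -sum1_size natr_sum; congr EFin.
  rewrite [RHS](eq_bigr (fun x => if x \in B then 1 else 0)); last first.
    by move=> x _; rewrite indicE; case: ifP.
  rewrite -big_mkcond -[RHS]big_filter; apply: perm_big; apply: uniq_perm.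
  - exact: finmap.fset_uniq.
  - by rewrite filter_uniq// index_enum_uniq.
  - move=> x; rewrite mem_filter mem_index_enum andbT.
    by rewrite in_fset_set//; exact: finite_finset.
have nE (mu : {measure set (vert n) -> \bar R}) (P : probability (vert n) R) :
    mu setT = (n.+1%:R)%:E -> mnormalize mu P A = (mu A * (n.+1%:R^-1)%:E)%E.
  by rewrite /mnormalize => ->; rewrite eqe pnatr_eq0.
rewrite /unif [LHS]nE; last by rewrite [LHS]cE indicT sumr_const card_ord.
by rewrite [X in (X * _)%E]cE -EFinM.
Qed.

Lemma integral_unif g : (forall x, 0 <= g x) ->
  (\int[unif R n]_x (g x)%:E = (avg g)%:E)%E.
Proof.
move=> g0.
have gE x : ((g x)%:E = \sum_(y : vert n) (g y * \1_[set y] x)%:E)%E.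
  rewrite sumEFin (bigD1 x)//= indicE in_set1 eqxx mulr1 big1 ?addr0// => y yx.
  by rewrite indicE in_set1 eq_sym (negbTE yx) mulr0.
under eq_integral do rewrite gE.
rewrite ge0_integral_sum//; last first.
  by move=> y x _; rewrite lee_fin mulr_ge0.
rewrite /avg mulr_suml -sumEFin; apply: eq_bigr => y _.
under eq_integral do rewrite EFinM.
rewrite ge0_integralZl ?lee_fin//.
rewrite integral_indic// setIT [X in (_ * X)%E]unifE -EFinM; congr (_ * _)%:E.
rewrite /pr /avg (bigD1 y)//= indicE in_set1 eqxx big1 ?addr0 ?mul1r// => x xy.
by rewrite indicE in_set1 (negbTE xy).
Qed.


End averages.

(** * Internal sets *)

(* [R] is a phantom parameter: it is the field in which the measure takes its
   values, and the sigma-algebra put on [uprod R N] depends on it. No quotient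
   by the ultrafilter is taken. *)
Definition uprod (R : realType) (N : nat -> nat) : Type := forall i, vert (N i).

Section internal_sets.
Variables (R : realType) (N : nat -> nat).
Local Notation iset := (forall i, set (vert (N i))).
Implicit Types A B : iset.

Definition internal A : set (uprod R N) :=
  [set w | \forall i \near nat_ultra, A i (w i)].

Definition ulim_pr A : R := lim ((fun i => pr R (A i)) @ nat_ultra).

Lemma cvg_ulim_pr A : (fun i => pr R (A i)) @ nat_ultra --> ulim_pr A.
Proof.
apply: (@bounded_ultra_cvg _ 1); apply: nearW => i.
by rewrite ger0_norm ?pr_ge0 ?pr_le1.
Qed.

Arguments cvg_ulim_pr : clear implicits.

Lemma le_ulim_pr A B : (\forall i \near nat_ultra, A i `<=` B i) ->
  ulim_pr A <= ulim_pr B.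
Proof.
move=> AB; apply: (ultra_le_lim (cvg_ulim_pr A) (cvg_ulim_pr B)).
by apply: filterS AB => i; exact: le_pr.
Qed.

Lemma ulim_pr_le A l : (\forall i \near nat_ultra, pr R (A i) <= l) ->
  ulim_pr A <= l.
Proof. exact: cvgr_to_le (cvg_ulim_pr A). Qed.

Lemma ulim_pr_ge A l : (\forall i \near nat_ultra, l <= pr R (A i)) ->
  l <= ulim_pr A.
Proof. exact: cvgr_to_ge (cvg_ulim_pr A). Qed.

Lemma ulim_pr_ge0 A : 0 <= ulim_pr A.
Proof. by apply: ulim_pr_ge; apply: nearW => i; exact: pr_ge0. Qed.

Lemma ulim_pr0 : ulim_pr (fun=> set0) = 0.
Proof.
apply/eqP; rewrite eq_le ulim_pr_ge0 andbT.
by apply: ulim_pr_le; apply: nearW => i; rewrite pr0.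
Qed.

Lemma ulim_prT : ulim_pr (fun=> setT) = 1.
Proof.
apply/eqP; rewrite eq_le; apply/andP; split.
  by apply: ulim_pr_le; apply: nearW => i; rewrite prT.
by apply: ulim_pr_ge; apply: nearW => i; rewrite prT.
Qed.

Lemma ulim_prUI A B :
  ulim_pr (fun i => A i `|` B i) + ulim_pr (fun i => A i `&` B i) =
  ulim_pr A + ulim_pr B.
Proof.
apply: (cvg_unique _ (cvgD (cvg_ulim_pr _) (cvg_ulim_pr _))) => //.
rewrite (_ : _ + _ = (fun i => pr R (A i)) + (fun i => pr R (B i))).
  exact: cvgD (cvg_ulim_pr _) (cvg_ulim_pr _).
by apply/funext => i; exact: prUI.
Qed.

Lemma ulim_prDI A B :
  ulim_pr (fun i => A i `\` B i) + ulim_pr (fun i => A i `&` B i) = ulim_pr A.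
Proof.
apply: (cvg_unique _ (cvgD (cvg_ulim_pr _) (cvg_ulim_pr _))) => //.
rewrite (_ : _ + _ = (fun i => pr R (A i))); first exact: cvg_ulim_pr.
by apply/funext => i; exact: prDI.
Qed.

Lemma ulim_prU A B :
  ulim_pr (fun i => A i `|` B i) <= ulim_pr A + ulim_pr B.
Proof. by rewrite -ulim_prUI lerDl ulim_pr_ge0. Qed.

Lemma internalC A : internal (fun i => ~` A i) = ~` internal A.
Proof.
apply/seteqP; split=> w /=; last exact: ultraN.
by move=> Aw Aw'; have [i []] := filter_ex (filterI Aw Aw').
Qed.

Lemma internalI A B :
  internal (fun i => A i `&` B i) = internal A `&` internal B.
Proof.
apply/seteqP; split=> w /= => [AB|[]]; last exact: filterI.
by split; apply: filterS AB => i [].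
Qed.

Lemma internalU A B :
  internal (fun i => A i `|` B i) = internal A `|` internal B.
Proof.
rewrite -[RHS]setCK setCU -!internalC -internalI -internalC; congr internal.
by apply: functional_extensionality_dep => i; rewrite -setCU setCK.
Qed.

Lemma internalD A B :
  internal (fun i => A i `\` B i) = internal A `\` internal B.
Proof. by rewrite [RHS]setDE -internalC -internalI. Qed.

(** A point of [A i] outside [B i], chosen for each [i] where there is one, would form an element of
    [internal A] outside [internal B]. Inclusions on the ultraproduct thus transfer to the vertex
    sets. *)
Lemma internal_sub A B : internal A `<=` internal B ->
  \forall i \near nat_ultra, A i `<=` B i.
Proof.
move=> AB; apply: contrapT => /ultraN nAB.
have wP i : exists x, ~ A i `<=` B i -> A i x /\ ~ B i x.
  have [?|/existsNP[x]] := pselect (A i `<=` B i); first by exists ord0.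
  by move=> /not_implyP ?; exists x.
pose w i := projT1 (cid (wP i)).
have wAB : \forall i \near nat_ultra, A i (w i) /\ ~ B i (w i).
  by apply: filterS nAB => i; rewrite /w; case: cid.
have /AB wB : internal A w by apply: filterS wAB => i [].
by have [i [[]]] := filter_ex (filterI wAB wB).
Qed.

(* [B i] is the union of the first [n] sets [A k i], where [n <= i] is the
   largest index for which this union has probability at most l + 1/(n+1). *)
Lemma internal_saturation (A : nat -> iset) l : 0 <= l ->
  (forall n, ulim_pr (fun i => \bigcup_(k < n) A k i) <= l) ->
  exists B, (forall k, internal (A k) `<=` internal B) /\ ulim_pr B <= l.
Proof.
move=> l0 Al; pose C n i := \bigcup_(k < n) A k i.
pose P i (n : 'I_i.+1) := pr R (C n i) <= l + n.+1%:R^-1.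
have P0 i : P i ord0.
  by rewrite /P /C bigcup_mkord big_ord0 pr0 addr_ge0.
pose m i := [arg max_(n > ord0 | P i n) (n : nat)]%N.
have CS n n' i : (n <= n')%N -> C n i `<=` C n' i.
  by move=> nn' x [k /= kn Akx]; exists k => //=; exact: leq_trans nn'.
(* For fixed [n], the index [n] is admissible for most [i] (in the sense of the ultrafilter), so [m]
   tends to infinity along the ultrafilter. *)
have near_m n : \forall i \near nat_ultra, (n <= m i)%N.
  have Cn : \forall i \near nat_ultra, pr R (C n i) < l + n.+1%:R^-1.
    apply: (cvgr_lt (ulim_pr (C n)) (cvg_ulim_pr (C n))).
    by rewrite (le_lt_trans (Al n))// ltrDl invr_gt0.
  apply: filterS2 Cn (near_ultra_ge n) => i Cni ni; rewrite /m.
  case: arg_maxnP => // m0 Pm0 /(_ (Ordinal (ni : n < i.+1)%N)); apply.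
  exact: ltW.
exists (fun i => C (m i) i); split=> [k w Akw|].
  apply: filterS2 Akw (near_m k.+1) => i Aki km.
  by apply: CS km _ _; exists k => /=.
apply/ler_addgt0Pr => e e0.
have [n ne] := exists_natSinv_lt e0.
apply: ulim_pr_le; apply: filterS (near_m n) => i nm.
apply: (@le_trans _ _ (l + (m i).+1%:R^-1)).
  by rewrite /m; case: arg_maxnP.
rewrite lerD2l (le_trans _ (ltW ne))//.
by rewrite lef_pV2 ?posrE// ler_nat ltnS.
Qed.

End internal_sets.

Arguments cvg_ulim_pr {R N} A.

(** * The Loeb measure *)

Section null_sets.
Variables (R : realType) (N : nat -> nat).
Local Notation iset := (forall i, set (vert (N i))).
Implicit Types (A B : iset) (S T : set (uprod R N)).

(** Outer measure zero. By saturation, covers by countably many internal sets would define the same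
    notion. *)
Definition null S :=
  forall e : R, 0 < e -> exists A, S `<=` internal A /\ ulim_pr R A <= e.

Lemma sub_null S T : S `<=` T -> null T -> null S.
Proof.
by move=> ST T0 e /T0[A [TA Ae]]; exists A; split=> //; exact: subset_trans TA.
Qed.

Lemma bigcup_ltS (F : nat -> iset) n i :
  \bigcup_(k < n.+1) F k i = (\bigcup_(k < n) F k i) `|` F n i.
Proof.
apply/seteqP; split=> x.
  move=> [k /=]; rewrite ltnS leq_eqVlt => /orP[/eqP ->|kn]; first by right.
  by left; exists k.
by case=> [[k /= kn Fk]|Fn]; [exists k => //=; exact: ltnW | exists n => /=].
Qed.

(** Cover the [k]-th set up to [e / 2^(k+1)]; saturation merges the countably many covers into one
    internal set without raising the bound [e]. *)
Lemma null_bigcup (S : nat -> set (uprod R N)) :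
  (forall k, null (S k)) -> null (\bigcup_k S k).
Proof.
move=> S0 e e0.
have ek k : 0 < e / 2 ^+ k.+1 by rewrite divr_gt0.
pose A k := projT1 (cid (S0 k _ (ek k))).
have AP k : S k `<=` internal (A k) /\ ulim_pr R (A k) <= e / 2 ^+ k.+1.
  by rewrite /A; case: cid.
have Ae n : ulim_pr R (fun i => \bigcup_(k < n) A k i) <= e * (1 - 2 ^- n).
  elim: n => [|n ih].
    rewrite expr0 invr1 subrr mulr0 -(ulim_pr0 R N) le_ulim_pr//.
    by apply: nearW => i; rewrite bigcup_mkord big_ord0.
  have -> : (fun i => \bigcup_(k < n.+1) A k i) =
      (fun i => (\bigcup_(k < n) A k i) `|` A n i).
    by apply: functional_extensionality_dep => i; rewrite bigcup_ltS.
  rewrite (le_trans (ulim_prU _ _ _))// (le_trans (lerD ih (AP n).2))//.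
  rewrite exprS invfM; lra.
have [|B [AB Be]] := internal_saturation (ltW e0) (A := A).
  move=> n; rewrite (le_trans (Ae n))// ler_piMr ?ltW// gerBl.
by exists B; split=> // w [k _ Skw]; apply: (AB k); exact: (AP k).1.
Qed.

Lemma null0 : null set0.
Proof.
move=> e e0; exists (fun=> set0); split=> //.
by rewrite ulim_pr0 ltW.
Qed.

Lemma nullU S T : null S -> null T -> null (S `|` T).
Proof.
move=> S0 T0; rewrite -bigcup2E; apply: null_bigcup => -[|[|k]] //=.
exact: null0.
Qed.

Lemma null_internal A : null (internal A) -> ulim_pr R A = 0.
Proof.
move=> A0; apply/eqP; rewrite eq_le ulim_pr_ge0 andbT.
apply/ler_addgt0Pr => e /A0[B [/internal_sub AB Be]]; rewrite add0r.
by apply: le_trans Be; exact: le_ulim_pr.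
Qed.

Definition approx S A := null ((S `\` internal A) `|` (internal A `\` S)).

(** The part of [internal A] outside [internal B] lies in the union of three null sets, so its
    probability is 0. With [S = T], used in both directions, this makes the Loeb measure independent
    of the approximant. *)
Lemma le_approx S T A B : approx S A -> approx T B -> null (S `\` T) ->
  ulim_pr R A <= ulim_pr R B.
Proof.
move=> SA TB ST; rewrite -(ulim_prDI R A B) null_internal ?add0r.
  by apply: le_ulim_pr; apply: nearW => i x [].
rewrite internalD; apply: sub_null (nullU SA (nullU TB ST)) => w [Aw Bw].
have [Sw|] := pselect (S w); last by left; right.
by have [Tw|] := pselect (T w); right; [left; left|right].
Qed.

Lemma approx_internal A : approx (internal A) A.
Proof. by rewrite /approx setDv setU0; exact: null0. Qed.

Lemma approxC S A : approx S A -> approx (~` S) (fun i => ~` A i).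
Proof.
apply: sub_null => w; rewrite internalC => -[[Sw /contrapT Aw]|[Aw /contrapT Sw]].
  by right.
by left.
Qed.

Lemma approxU S T A B : approx S A -> approx T B ->
  approx (S `|` T) (fun i => A i `|` B i).
Proof.
move=> SA TB; apply: sub_null (nullU SA TB) => w; rewrite internalU.
by move=> [[[Sw|Tw] /not_orP[]]|[[Aw|Bw] /not_orP[]]];
  [left; left|right; left|left; right|right; right].
Qed.

(** Saturation is applied at the supremum of the probabilities of the finite unions [C n]. The
    resulting [B] exceeds the union of the [internal (A k)] by a null set only, since [B] minus
    [C n] becomes small. The last clause says that [B] stays within this supremum, as
    sigma-additivity requires. *)
Lemma approx_bigcup (S : nat -> set (uprod R N)) (A : nat -> iset) :
  (forall k, approx (S k) (A k)) ->
  exists B, [/\ approx (\bigcup_k S k) B,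
    forall k, internal (A k) `<=` (internal B : set (uprod R N)) &
    forall l, (forall n, ulim_pr R (fun i => \bigcup_(k < n) A k i) <= l) ->
      ulim_pr R B <= l].
Proof.
move=> SA; pose C n i := \bigcup_(k < n) A k i.
pose D := range (fun n => ulim_pr R (C n)).
have D_sup : has_sup D.
  split; first by exists (ulim_pr R (C 0%N)), 0%N.
  exists 1 => _ [n _ <-]; rewrite -(ulim_prT R N).
  by apply: le_ulim_pr; apply: nearW.
have CD n : ulim_pr R (C n) <= sup D by apply: ub_le_sup D_sup.2 _ _; exists n.
have D0 : 0 <= sup D by rewrite (le_trans _ (CD 0%N))// ulim_pr_ge0.
have [B [AB BD]] := internal_saturation D0 CD.
have CB n : internal (C n) `<=` (internal B : set (uprod R N)).
  elim: n => [|n ih] w.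
    by move=> /filter_ex[i]; rewrite /C bigcup_mkord big_ord0.
  move=> Cw; have : internal (fun i => C n i `|` A n i) w.
    by apply: filterS Cw => i; rewrite /C bigcup_ltS.
  by rewrite internalU => -[/ih|/AB].
have Bsup l : (forall n, ulim_pr R (C n) <= l) -> ulim_pr R B <= l.
  move=> Cl; rewrite (le_trans BD)//; apply: ge_sup => [|_ [n _ <-]//].
  exact: D_sup.1.
exists B; split=> //.
apply: (@sub_null _ ((\bigcup_k ((S k `\` internal (A k)) `|`
    (internal (A k) `\` S k))) `|`
    (internal B `\` \bigcup_k internal (A k)))).
  move=> w [[[k _ Skw] Bw]|[Bw Sw]].
    by left; exists k => //; left; split=> // /AB.
  have [[k _ Akw]|] := pselect ((\bigcup_k internal (A k)) w); last by right.
  by left; exists k => //; right; split=> // Skw; apply: Sw; exists k.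
apply: nullU; first exact: null_bigcup.
(* Otherwise [Bsup] would bound the probability of [B] by itself minus [e]. *)
move=> e e0; have [n Cn] : exists n, ulim_pr R B - e < ulim_pr R (C n).
  apply: contrapT => /forallNP Cn.
  have /Bsup : forall n, ulim_pr R (C n) <= ulim_pr R B - e.
    by move=> n; rewrite leNgt; apply/negP/Cn.
  by apply/negP; rewrite -ltNge ltrBlDr ltrDl.
exists (fun i => B i `\` C n i); split.
  rewrite internalD => w [Bw Aw]; split=> // Cw; apply: Aw.
  elim: n {Cn} Cw => [|n ih].
    by move=> /filter_ex[i]; rewrite /C bigcup_mkord big_ord0.
  move=> Cw; have : internal (fun i => C n i `|` A n i) w.
    by apply: filterS Cw => i; rewrite /C bigcup_ltS.
  by rewrite internalU => -[/ih//|Anw]; exists n.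
have : ulim_pr R (C n) <= ulim_pr R (fun i => B i `&` C n i).
  have CBn := internal_sub (CB n).
  apply: le_ulim_pr; apply: filterS CBn => i CBi x Cx.
  by split=> //; exact: CBi.
have := ulim_prDI R B (C n); lra.
Qed.

Definition loeb_measurable S := exists A, approx S A.

Lemma loeb_measurable0 : loeb_measurable set0.
Proof.
exists (fun=> set0); rewrite /approx set0D setD0 set0U.
by apply: sub_null null0 => w /filter_ex[].
Qed.

Lemma loeb_measurableC S : loeb_measurable S -> loeb_measurable (~` S).
Proof. by move=> [A SA]; exists (fun i => ~` A i); exact: approxC. Qed.

Lemma loeb_measurable_bigcup (S : nat -> set (uprod R N)) :
  (forall k, loeb_measurable (S k)) -> loeb_measurable (\bigcup_k S k).
Proof.
move=> /choice[A SA]; have [B [SB _ _]] := approx_bigcup SA.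
by exists B.
Qed.

End null_sets.

HB.instance Definition _ (R : realType) (N : nat -> nat) :=
  gen_eqMixin (uprod R N).
HB.instance Definition _ (R : realType) (N : nat -> nat) :=
  gen_choiceMixin (uprod R N).
HB.instance Definition _ (R : realType) (N : nat -> nat) :=
  isPointed.Build (uprod R N) (fun i => ord0).
HB.instance Definition _ (R : realType) (N : nat -> nat) :=
  @isMeasurable.Build default_measure_display (uprod R N)
    (@loeb_measurable R N) (@loeb_measurable0 R N) (@loeb_measurableC R N)
    (@loeb_measurable_bigcup R N).

Section loeb_measure.
Variables (R : realType) (N : nat -> nat).
Implicit Types S : set (uprod R N).

(** The default 0 keeps the values in [0, 1] even off the sigma-algebra, so that laws are
    [unit_valued] on all sets. *)
Definition loeb S : \bar R :=
  if pselect (exists A, approx S A) is left SA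
  then (ulim_pr R (projT1 (cid SA)))%:E else 0%E.

Lemma loebE S A : approx S A -> loeb S = (ulim_pr R A)%:E.
Proof.
rewrite /loeb => SA; case: pselect => [SA'|[]]; last by exists A.
case: cid => B SB /=; congr EFin; apply/eqP.
have S0 : null (S `\` S) by rewrite setDv; exact: null0.
by rewrite eq_le (le_approx SB SA S0) (le_approx SA SB S0).
Qed.

Lemma loeb0 : loeb set0 = 0%E.
Proof.
rewrite (@loebE _ (fun=> set0)) ?ulim_pr0//.
rewrite /approx set0D setD0 set0U.
by apply: sub_null (@null0 R N) => w /filter_ex[].
Qed.

Lemma loeb_ge0 S : (0 <= loeb S)%E.
Proof. by rewrite /loeb; case: pselect => // SA; rewrite lee_fin ulim_pr_ge0. Qed.

(** The measure of a finite union is the probability of [C n], which is additive because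
    disjointness of the [F k] makes the overlaps of the approximants null. These probabilities
    increase to that of [B] by the last clause of [approx_bigcup]. *)
Lemma loeb_semi_sigma_additive : semi_sigma_additive loeb.
Proof.
move=> F /choice[A FA] tF _.
have [B [FB AB Bsup]] := approx_bigcup FA.
pose C n i := \bigcup_(k < n) A k i.
have FC n : approx (\bigcup_(k < n) F k) (C n).
  elim: n => [|n ih].
    rewrite /approx /C bigcup_mkord big_ord0 set0D setD0 set0U.
    apply: sub_null (@null0 R N) => w /filter_ex[i].
    by rewrite bigcup_mkord big_ord0.
  have := approxU ih (FA n); congr approx.
    rewrite !bigcup_mkord big_ord_recr//.
  by apply: functional_extensionality_dep => i; rewrite /C bigcup_ltS.
have CB n : ulim_pr R (C n) <= ulim_pr R B.
  apply: le_approx (FC n) FB _.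
  rewrite (_ : _ `\` _ = set0); first exact: null0.
  by apply/seteqP; split=> // w [[k _ Fk] []]; exists k.
rewrite (loebE FB).
have -> : (fun n => (\sum_(0 <= k < n) loeb (F k))%E) =
    (fun n => (ulim_pr R (C n))%:E).
  apply/funext; elim=> [|n ih].
    rewrite big_geq//; congr EFin; apply/esym/null_internal.
    apply: sub_null (@null0 R N) => w /filter_ex[i].
    by rewrite /C bigcup_mkord big_ord0.
  rewrite big_nat_recr//= ih (loebE (FA n)) -EFinD; congr EFin.
  rewrite -ulim_prUI [X in _ + X]null_internal ?addr0.
    by congr ulim_pr; apply: functional_extensionality_dep => i; rewrite /C bigcup_ltS.
  rewrite internalI; apply: sub_null (nullU (FC n) (FA n)) => w [Cw Aw].
  have [Fw|] := pselect ((\bigcup_(k < n) F k) w); last by left; right.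
  have [Fnw|] := pselect (F n w); last by right; right.
  case: Fw => k /= kn Fkw; have kE : k = n by apply: tF => //; exists w.
  by rewrite kE ltnn in kn.
apply: cvg_EFin; first exact: nearW.
apply/cvgrPdist_lt => e e0.
have [m Cm] : exists n, ulim_pr R B - e < ulim_pr R (C n).
  apply: contrapT => /forallNP Cn.
  have /Bsup : forall n, ulim_pr R (C n) <= ulim_pr R B - e.
    by move=> n; rewrite leNgt; apply/negP/Cn.
  by apply/negP; rewrite -ltNge ltrBlDr ltrDl.
exists m => // n /= mn; rewrite ger0_norm ?subr_ge0//.
rewrite ltrBlDr -ltrBlDl (lt_le_trans Cm)//; apply: le_ulim_pr.
by apply: nearW => i x [k /= km Akx]; exists k => //=; exact: leq_trans mn.
Qed.

HB.instance Definition _ := isMeasure.Build default_measure_display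
  (uprod R N) R loeb loeb0 loeb_ge0 loeb_semi_sigma_additive.

Lemma loebT : loeb setT = 1%E.
Proof.
rewrite (@loebE _ (fun=> setT)) ?ulim_prT//.
have -> : [set: uprod R N] = internal (fun=> setT).
  by apply/seteqP; split=> // w _; apply: nearW.
exact: approx_internal.
Qed.

HB.instance Definition _ := Measure_isProbability.Build default_measure_display
  (uprod R N) R loeb loebT.

Definition loebP : probability (uprod R N) R := loeb.

End loeb_measure.

(** * Ultralimits of functions *)

Section dyadic.
Variable R : realType.
Implicit Types x : R.

(** The greedy binary truncation to [n] digits of a number in [0, 1]; at 1 all digits are 1, so the
    error bound [2^-n] holds on the closed interval. Digits reduce functions to sets, on which the
    Loeb measure is defined. *)
Fixpoint dyad (n : nat) x : R :=
  if n is m.+1 then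
    dyad m x + (if dyad m x + 2 ^- m.+1 <= x then 2 ^- m.+1 else 0)
  else 0.

Definition digit n x := dyad n x + 2 ^- n.+1 <= x.

Lemma dyadE n x : dyad n x = \sum_(k < n) 2 ^- k.+1 * (digit k x)%:R.
Proof.
elim: n => [|n ih]; first by rewrite big_ord0.
by rewrite big_ord_recr -ih /= /digit; case: ifP; rewrite ?mulr1 ?mulr0.
Qed.

Lemma dyad_bounds n x : 0 <= x <= 1 -> dyad n x <= x <= dyad n x + 2 ^- n.
Proof.
move=> x01; elim: n => [|n ih]; first by rewrite expr0 invr1 add0r.
have h : (2 : R) ^- n = 2 ^- n.+1 + 2 ^- n.+1 by rewrite exprS invfM; lra.
by move: ih; rewrite h /=; case: ifP => d /andP[]; lra.
Qed.

Lemma sum_dyad n : \sum_(k < n) 2 ^- k.+1 = 1 - 2 ^- n :> R.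
Proof.
elim: n => [|n ih]; first by rewrite big_ord0 expr0 invr1 subrr.
by rewrite big_ord_recr ih /= exprS invfM; lra.
Qed.

(** The weights between [n] and [m] sum to [2^-n - 2^-m]. The lemma serves binary expansions and the
    series of [dM] alike. *)
Lemma dyadic_tail (b : nat -> R) n m : (forall k, 0 <= b k <= 1) -> (n <= m)%N ->
  \sum_(k < n) 2 ^- k.+1 * b k <= \sum_(k < m) 2 ^- k.+1 * b k
  <= \sum_(k < n) 2 ^- k.+1 * b k + (2 ^- n - 2 ^- m).
Proof.
move=> b01 /subnKC <-; elim: (m - n)%N => [|j /andP[ih1 ih2]].
  by rewrite addn0 subrr addr0 lexx.
have /andP[b0 b1] := b01 (n + j)%N.
have h : (2 : R) ^- (n + j) = 2 ^- (n + j).+1 + 2 ^- (n + j).+1.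
  by rewrite exprS invfM; lra.
have h0 : 0 <= (2 : R) ^- (n + j).+1 by rewrite invr_ge0 exprn_ge0.
rewrite addnS big_ord_recr/=; move: ih2; rewrite h => ih2.
have c0 := mulr_ge0 h0 b0; have c1 := ler_piMr h0 b1.
apply/andP; split; lra.
Qed.

Lemma exists_dyad_lt (e : R) : 0 < e -> exists n, 2 ^- n < e.
Proof.
move=> /exists_natSinv_lt[n ne]; exists n; apply: le_lt_trans ne.
rewrite lef_pV2 ?posrE ?exprn_gt0// -natrX ler_nat.
exact: ltn_expl.
Qed.

Lemma measurable_dyad d (T : measurableType d) (v : T -> R) n :
  measurable_fun setT v -> measurable_fun setT (dyad n \o v).
Proof.
move=> mv; elim: n => [|n ih]; first exact: measurable_cst.
apply: measurable_funD => //=; apply: measurable_fun_ifT => //.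
by apply: measurable_fun_ler => //; exact: measurable_funD.
Qed.

Lemma measurable_digit d (T : measurableType d) (v : T -> R) n :
  measurable_fun setT v -> measurable [set w | digit n (v w)].
Proof.
move=> mv; rewrite -[X in measurable X]setTI -preimage_true.
apply: measurable_fun_ler => //; apply: measurable_funD => //.
exact: measurable_dyad.
Qed.

End dyadic.

Section lifts.
Variables (R : realType) (N : nat -> nat).
Local Notation iset := (forall i, set (vert (N i))).
Local Notation ifun := (forall i, vert (N i) -> R).
Local Notation Omega := (uprod R N).
Local Notation P := (loebP R N).
Implicit Types (A : iset) (S T : set Omega) (g : ifun) (v : Omega -> R).

#[global] Instance ae_loebP_filter : Filter (almost_everywhere P).
Proof. exact: ae_filter_ringOfSetsType. Qed.

(** A null set is approximated by the empty internal set: the Loeb measure is complete. Hence an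
    a.e. statement amounts to [null] of its failure set. *)
Lemma null_loeb S : null S -> measurable S /\ P S = 0%E.
Proof.
move=> S0; have SA : approx S (fun=> set0).
  by apply: sub_null (S0) => w [[Sw _ //]|[/filter_ex[]]].
have mS : loeb_measurable S by exists (fun=> set0).
by split=> //; rewrite [LHS](loebE SA) ulim_pr0.
Qed.

Lemma negligible_null S : P.-negligible S <-> null S.
Proof.
split=> [[T [[A TA]]]|/null_loeb[mS S0]]; last by exists S; split.
rewrite [P T](loebE TA) => -[A0] ST.
apply: (@sub_null _ _ _ ((T `\` internal A) `|` internal A)).
  move=> w /ST Tw; have [Aw|nAw] := pselect (internal A w); first by right.
  by left.
apply: nullU; first by apply: sub_null TA => w; left.
by move=> e e0; exists A; split=> //; rewrite A0 ltW.
Qed.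

Lemma ae_null (Q : Omega -> Prop) :
  (\forall w \ae P, Q w) <-> null (~` [set w | Q w]).
Proof. exact: negligible_null. Qed.

Lemma measurable_internal A : measurable (internal A : set Omega).
Proof. by exists A; exact: approx_internal. Qed.

Lemma loeb_internal A : P (internal A) = (ulim_pr R A)%:E.
Proof. exact: (loebE (approx_internal A)). Qed.

Lemma ae_measurable S T : measurable T -> (\forall w \ae P, S w <-> T w) ->
  measurable S.
Proof.
move=> [A TA] /ae_null ST; exists A.
apply: sub_null (nullU TA ST) => w [[Sw Aw]|[Aw Sw]].
  have [Tw|nTw] := pselect (T w); first by left; left.
  by right=> -[/(_ Sw)].
have [Tw|nTw] := pselect (T w); last by left; right.
by right=> -[_ /(_ Tw)].
Qed.

(** The liftings of Loeb theory: almost everywhere, [v] is the standard part of the internal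
    function given by [g]. *)
Definition lifts g v :=
  \forall w \ae P, (fun i => g i (w i)) @ nat_ultra --> v w.

(** [{v > t}] agrees a.e. with the union over [n] of the internal sets [{g >= t + 1/(n+1)}]; the
    positive gap lets the strict inequality survive the limit. *)
Lemma lifts_measurable g v : lifts g v -> measurable_fun setT v.
Proof.
move=> gv mT; apply: (measurability _ (RGenOInfty.measurableE R)) => //.
move=> _ [_ [t ->] <-]; rewrite setTI.
pose A n i := [set x | t + n.+1%:R^-1 <= g i x].
apply: (@ae_measurable _ (\bigcup_n internal (A n))).
  by apply: bigcup_measurable => n _; exact: measurable_internal.
apply: filterS gv => w gv /=; rewrite in_itv /= andbT; split.
  rewrite -subr_gt0 => /exists_natSinv_lt[n ne]; exists n => //.
  have tv : t + n.+1%:R^-1 < v w by rewrite -ltrBrDl.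
  by apply: filterS (cvgr_gt _ gv _ tv) => i /ltW.
move=> [n _ Anw]; have : t + n.+1%:R^-1 <= v w by exact: (cvgr_to_ge gv).
by apply: lt_le_trans; rewrite ltrDl invr_gt0.
Qed.

Lemma lifts_unique g v v' : lifts g v -> lifts g v' ->
  \forall w \ae P, v w = v' w.
Proof. by apply: filterS2 => w; exact: cvg_unique. Qed.

(* The binary digits of [v] are indicators of measurable sets; replace each of
   these sets by an internal one, and let [g i] use the first [i] digits. *)
Lemma lifts01 v : measurable_fun setT v -> (forall w, 0 <= v w <= 1) ->
  exists g, (forall i x, 0 <= g i x <= 1) /\ lifts g v.
Proof.
move=> mv v01; pose E k := [set w | digit k (v w)].
have /choice[A EA] : forall k, exists A, approx (E k) A.
  by move=> k; exact: (measurable_digit k mv).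
pose g i x : R := \sum_(k < i) 2 ^- k.+1 * \1_(A k i) x.
have gn n i x : (n <= i)%N ->
    \sum_(k < n) 2 ^- k.+1 * \1_(A k i) x <= g i x
    <= \sum_(k < n) 2 ^- k.+1 * \1_(A k i) x + (2 ^- n - 2 ^- i).
  move=> ni; apply: (@dyadic_tail _ (fun k => \1_(A k i) x)) ni => k.
  by rewrite indicE; case: (_ \in _); rewrite lexx ler01.
exists g; split=> [i x|].
  have /andP[] := gn 0%N i x (leq0n _).
  rewrite !big_ord0 add0r expr0 invr1 => -> gle /=.
  by rewrite (le_trans gle)// gerBl invr_ge0 exprn_ge0.
have : \forall w \ae P, forall k, E k w <-> internal (A k) w.
  apply/ae_null; apply: sub_null (null_bigcup EA) => w /existsNP[k EAk].
  exists k => //; have [Ew|nEw] := pselect (E k w).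
    by left; split=> // Aw; apply: EAk.
  right; split=> //; apply: contrapT => nAw; apply: EAk.
  by split.
apply: filterS => w EAw.
(* At fixed [w], the first [n] digits of [v w] are recorded by the [A k i] for most [i], so both
   [g i (w i)] and [v w] lie within [2^-n] above [dyad n (v w)]. *)
have near_digit n : \forall i \near nat_ultra,
    forall k : 'I_n, (\1_(A k i) (w i) : R) = (digit k (v w))%:R.
  apply: filter_forall => k /=.
  have [Ek|nEk] := pselect (E k w).
    apply: filterS ((EAw k).1 Ek) => i Ak.
    by rewrite indicE mem_set// Ek.
  have /ultraN : ~ internal (A k) w by move/(EAw k).2.
  apply: filterS => i nAk; rewrite indicE memNset//.
  by case: (boolP (digit k (v w))) nEk.
apply/subr_cvg0/ultra_cvg_squeeze0 => e /exists_dyad_lt[n ne].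
apply: filterS2 (near_digit n) (near_ultra_ge n) => i di ni.
have := gn n i (w i) ni; under eq_bigr do rewrite di.
rewrite -dyadE; have := dyad_bounds n (v01 w).
have : 0 <= (2 : R) ^- i by rewrite invr_ge0 exprn_ge0.
move=> i0 /andP[d1 d2] /andP[g1 g2]; rewrite ler_norml; apply/andP; split; lra.
Qed.

End lifts.

(** * Truncation at a level *)

Section clipping.
Variable R : realType.
Implicit Types x y K d : R.

Definition clip K x := Num.max (- K) (Num.min K x).

Lemma norm_clip_le K x : 0 <= K -> `|clip K x| <= K.
Proof.
move=> K0; rewrite ler_norml /clip; case: (leP K x) => ?.
  by case: (leP (- K) K) => ?; apply/andP; split; lra.
by case: (leP (- K) x) => ?; apply/andP; split; lra.
Qed.

Lemma clip_id K x : `|x| <= K -> clip K x = x.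
Proof.
rewrite ler_norml /clip => /andP[? ?]; case: (leP K x) => ?.
  by case: (leP (- K) K) => ?; lra.
by case: (leP (- K) x) => ?; lra.
Qed.

Lemma norm_clip K x : 0 <= K -> `|clip K x| <= `|x|.
Proof.
move=> K0; have [xK|Kx] := leP `|x| K; first by rewrite clip_id.
by rewrite (le_trans (norm_clip_le _ K0))// ltW.
Qed.

Lemma clip_lip K x y : `|clip K x - clip K y| <= `|x - y|.
Proof.
rewrite /clip; case: (leP K x) => ?; case: (leP K y) => ?;
  case: (leP (- K) K) => ?; case: (leP (- K) x) => ?; case: (leP (- K) y) => ?;
  rewrite ler_norml; case: (ger0P (x - y)) => ?; apply/andP; split; lra.
Qed.

(** The bound is the excess of [d] over [K], the quantity whose averages [unif_int] controls. *)
Lemma clip_tail K x d : 0 <= K -> `|x| <= d -> `|x - clip K x| <= d - Num.min d K.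
Proof.
move=> K0 xd; have [xK|Kx] := leP `|x| K.
  by rewrite clip_id// subrr normr0 subr_ge0 ge_min lexx.
have -> : Num.min d K = K by rewrite min_r// (le_trans (ltW Kx)).
move: xd Kx; rewrite /clip; case: (ger0P x) => x0 xd Kx.
  rewrite (min_l (ltW Kx)) max_r; last lra.
  by rewrite ger0_norm; lra.
rewrite min_r; last lra.
rewrite max_l; last lra.
by rewrite ler0_norm; lra.
Qed.

Lemma lip_cvg (phi : R -> R) (x : nat -> R) a :
  (forall y z, `|phi y - phi z| <= `|y - z|) ->
  x @ nat_ultra --> a -> (phi \o x) @ nat_ultra --> phi a.
Proof.
move=> phiL xa; apply/cvgrPdist_lt => e e0.
move/cvgrPdist_lt : xa => /(_ e e0); apply: filterS => i xi.
exact: le_lt_trans (phiL _ _) xi.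
Qed.

End clipping.

(** * Bounded liftings, and integrals of ultralimits with values in [0, 1] *)

Section lifts_integral.
Variables (R : realType) (N : nat -> nat).
Local Notation iset := (forall i, set (vert (N i))).
Local Notation Omega := (uprod R N).
Local Notation P := (loebP R N).
Implicit Types (g : forall i, vert (N i) -> R) (v : Omega -> R).

(** An affine map reduces this to [lifts01]. Clipping puts the values in the interval everywhere
    instead of a.e.; [M = 0] is separate because of the division by [M]. *)
Lemma lifts_bounded v M : 0 <= M -> measurable_fun setT v ->
  (\forall w \ae P, `|v w| <= M) ->
  exists g, (forall i x, `|g i x| <= M) /\ lifts g v.
Proof.
rewrite le_eqVlt => /orP[/eqP <-|M0] mv vM.
  exists (fun _ _ => 0); split=> [i x|]; first by rewrite normr0.
  by apply: filterS vM => w; rewrite normr_le0 => /eqP ->; exact: cvg_cst.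
pose u w := (clip M (v w) / M + 1) / 2.
have [|w|g [g01 gu]] := @lifts01 R N u.
- apply: measurable_funM => //; apply: measurable_funD => //.
  apply: measurable_funM => //; apply: measurable_maxr => //.
  exact: measurable_minr.
- rewrite /u; have := norm_clip_le (v w) (ltW M0).
  rewrite ler_norml => /andP[? ?].
  have : - 1 <= clip M (v w) / M by rewrite ler_pdivlMr// mulN1r.
  have : clip M (v w) / M <= 1 by rewrite ler_pdivrMr// mul1r.
  by move=> ? ?; apply/andP; split; lra.
exists (fun i x => M * (2 * g i x - 1)); split=> [i x|].
  rewrite normrM (gtr0_norm M0) ler_piMr ?(ltW M0)// ler_norml.
  by have /andP[? ?] := g01 i x; apply/andP; split; lra.
apply: filterS2 gu vM => w gu vM.
have -> : v w = M * (2 * u w - 1).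
  by rewrite /u clip_id//; field; rewrite gt_eqF.
by apply: cvgMr; apply: cvgB; [apply: cvgMr|exact: cvg_cst].
Qed.

(** Truncate [g i] to [n] binary digits. A digit cuts out an internal set, so the integral of the
    truncation is the ultralimit of its averages; on both sides the truncation costs at most
    [2^-n]. *)
Lemma lifts_integral01 g v (l : R) : (forall i x, 0 <= g i x <= 1) ->
  (forall w, 0 <= v w) -> lifts g v ->
  (fun i => avg (g i)) @ nat_ultra --> l -> (\int[P]_w (v w)%:E = l%:E)%E.
Proof.
move=> g01 v0 gv gl; have mv := lifts_measurable gv.
pose D k i := [set x | digit k (g i x)].
(* The digits are those of [g i], taken before the limit: a digit is a discontinuous function, so
   that of [v w] may differ. *)
pose s n (w : Omega) : R := \sum_(k < n) 2 ^- k.+1 * \1_(internal (D k)) w.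
pose t n : R := \sum_(k < n) 2 ^- k.+1 * ulim_pr R (D k).
have s0 n w : 0 <= s n w.
  by apply: sumr_ge0 => k _; rewrite mulr_ge0// invr_ge0 exprn_ge0.
have ms k : measurable_fun setT (\1_(internal (D k)) : Omega -> R).
  by apply: measurable_indic; exact: measurable_internal.
have mS n : measurable_fun setT (s n).
  by apply: measurable_sum => k; exact: measurable_funM.
have int_s n : (\int[P]_w (s n w)%:E = (t n)%:E)%E.
  under eq_integral do rewrite /s -sumEFin.
  rewrite ge0_integral_sum//; last first.
    by move=> k; apply/measurable_EFinP; exact: measurable_funM.
  rewrite -sumEFin; apply: eq_bigr => k _.
  under eq_integral do rewrite EFinM.
  rewrite ge0_integralZl//; last exact/measurable_EFinP.
  rewrite integral_indic//; last exact: measurable_internal.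
  by rewrite setIT [X in (_ * X)%E]loeb_internal.
have g_dyad n i x : dyad n (g i x) = \sum_(k < n) 2 ^- k.+1 * \1_(D k i) x.
  rewrite dyadE; apply: eq_bigr => k _; congr (_ * _).
  rewrite indicE; congr (nat_of_bool _)%:R.
  by apply/idP/idP => [/mem_set|/set_mem].
have near_s n (w : Omega) : \forall i \near nat_ultra, dyad n (g i (w i)) = s n w.
  have near_digit : \forall i \near nat_ultra,
      forall k : 'I_n, (\1_(D k i) (w i) : R) = \1_(internal (D k)) w.
    apply: filter_forall => k /=.
    have [Dk|nDk] := pselect (internal (D k) w).
      by apply: filterS (Dk) => i Dki; rewrite !indicE !mem_set.
    apply: filterS (ultraN nDk) => i nDki.
    by rewrite !indicE !memNset.
  apply: filterS near_digit => i di; rewrite g_dyad.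
  by apply: eq_bigr => k _; rewrite di.
have sv n : \forall w \ae P, s n w <= v w <= s n w + 2 ^- n.
  apply: filterS gv => w gv.
  apply/andP; split.
    apply: (cvgr_to_ge gv); apply: filterS (near_s n w) => i <-.
    by have /andP[] := dyad_bounds n (g01 i (w i)).
  apply: (cvgr_to_le gv); apply: filterS (near_s n w) => i <-.
  by have /andP[] := dyad_bounds n (g01 i (w i)).
have tl n : t n <= l <= t n + 2 ^- n.
  have cvt : (fun i => avg (fun x => dyad n (g i x))) @ nat_ultra --> t n.
    have -> : (fun i => avg (fun x => dyad n (g i x))) =
        (fun i => \sum_(k < n) 2 ^- k.+1 * pr R (D k i)).
      apply/funext => i; under [X in avg X]funext do rewrite g_dyad.
      by rewrite avg_sum; apply: eq_bigr => k _; rewrite avgZ.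
    apply: cvg_big => [|k _]; first exact: add_continuous.
    by apply: cvgMr; exact: cvg_ulim_pr.
  apply/andP; split.
    apply: (ultra_le_lim cvt gl); apply: nearW => i; apply: ler_avg => x.
    by have /andP[] := dyad_bounds n (g01 i x).
  have cvt2 : (fun i => avg (fun x => dyad n (g i x)) + 2 ^- n) @ nat_ultra -->
      t n + 2 ^- n by apply: cvgD => //; exact: cvg_cst.
  apply: (ultra_le_lim gl cvt2); apply: nearW => i /=; rewrite -[X in _ <= _ + X](avg_cst (N i)) -avgD.
  by apply: ler_avg => x; have /andP[] := dyad_bounds n (g01 i x).
have n0 n : 0 <= (2 : R) ^- n by rewrite invr_ge0 exprn_ge0.
have tI n : ((t n)%:E <= \int[P]_w (v w)%:E <= (t n + 2 ^- n)%:E)%E.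
  apply/andP; split.
    rewrite -int_s; apply: ae_ge0_le_integral => //.
    - by move=> w _; rewrite lee_fin.
    - exact/measurable_EFinP.
    - by move=> w _; rewrite lee_fin.
    - exact/measurable_EFinP.
    - by apply: filterS (sv n) => w /andP[? ?] _; rewrite lee_fin.
  have -> : (t n + 2 ^- n)%:E = (\int[P]_w (s n w + 2 ^- n)%:E)%E.
    under eq_integral do rewrite EFinD.
    rewrite ge0_integralD//; last 2 first.
    - by move=> w _; rewrite lee_fin.
    - exact/measurable_EFinP.
    by rewrite int_s integral_cst// [X in (_ * X)%E]loebT mule1.
  apply: ae_ge0_le_integral => //.
  - by move=> w _; rewrite lee_fin.
  - exact/measurable_EFinP.
  - by move=> w _; rewrite lee_fin addr_ge0.
  - by apply/measurable_EFinP; exact: measurable_funD.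
  - by apply: filterS (sv n) => w /andP[? ?] _; rewrite lee_fin.
have : (\int[P]_w (v w)%:E)%E \is a fin_num.
  have /andP[h1 h2] := tI 0%N; rewrite fin_numElt.
  by rewrite (lt_le_trans (ltNyr _) h1) (le_lt_trans h2 (ltry _)).
move: tI; case: (\int[P]_w (v w)%:E)%E => // r tI _; congr EFin.
apply/eqP; rewrite -subr_eq0 -normr_le0; apply/ler_addgt0Pr => e.
move=> /exists_dyad_lt[n ne]; rewrite add0r (le_trans _ (ltW ne))//.
have := tI n; rewrite !lee_fin => /andP[? ?]; have /andP[? ?] := tl n.
by rewrite ler_norml; apply/andP; split; lra.
Qed.

End lifts_integral.

(** * Uniform integrability and dominated ultralimits *)

Section dominated.
Variables (R : realType) (N : nat -> nat).
Local Notation ifun := (forall i, vert (N i) -> R).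
Local Notation Omega := (uprod R N).
Local Notation P := (loebP R N).
Implicit Types (g d : ifun) (v : Omega -> R) (K l : R).

Lemma lifts_comp (phi : R -> R) g v :
  (forall y z, `|phi y - phi z| <= `|y - z|) ->
  lifts g v -> lifts (fun i x => phi (g i x)) (phi \o v).
Proof. by move=> phiL; apply: filterS => w; exact: lip_cvg. Qed.

Lemma lifts_integral_bounded g v K l : 0 < K -> (forall i x, `|g i x| <= K) ->
  (forall w, `|v w| <= K) -> lifts g v ->
  (fun i => avg (g i)) @ nat_ultra --> l -> (\int[P]_w (v w)%:E = l%:E)%E.
Proof.
move=> K0 gK vK gv gl; pose r := (2 * K)^-1.
have r0 : 0 < r by rewrite invr_gt0 mulr_gt0.
have r01 y : `|y| <= K -> 0 <= r * (y + K) <= 1.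
  rewrite ler_norml => /andP[? ?]; apply/andP; split.
    by rewrite mulr_ge0 ?(ltW r0)//; lra.
  by rewrite /r mulrC ler_pdivrMr ?mulr_gt0//; lra.
pose u w := r * (v w + K).
have lu : lifts (fun i x => r * (g i x + K)) u.
  by apply: filterS gv => w gv; apply: cvgMr; apply: cvgD => //; exact: cvg_cst.
have uI : (\int[P]_w (u w)%:E = (r * (l + K))%:E)%E.
  apply: (lifts_integral01 _ _ lu) => [i x|w|].
  - exact: r01.
  - by have /andP[] := r01 _ (vK w).
  have -> : (fun i => avg (fun x => r * (g i x + K))) =
      (fun i => r * (avg (g i) + K)).
    by apply/funext => i; rewrite avgZ avgD avg_cst.
  by apply: cvgMr; apply: cvgD => //; exact: cvg_cst.
have mu : measurable_fun setT u := lifts_measurable lu.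
have iu : P.-integrable setT (EFin \o u).
  apply: measurable_bounded_integrable => //.
    by rewrite [X in (X < _)%E]loebT ltry.
  exists 1; split; first exact: num_real.
  move=> y y1 w _ /=; have /andP[u0 u1] := r01 _ (vK w).
  by rewrite ger0_norm// (le_trans u1)// ltW.
have -> : (\int[P]_w (v w)%:E = \int[P]_w ((2 * K)%:E * (u w)%:E - K%:E))%E.
  apply: eq_integral => w _; rewrite -EFinM -EFinB; congr EFin.
  by rewrite /u /r; field; rewrite gt_eqF.
rewrite integralB//; last 2 first.
- exact: integrableZl.
- exact: finite_measure_integrable_cst.
rewrite integralZl// uI integral_cst// [X in (K%:E * X)%E]loebT mule1.
rewrite -EFinM -EFinB; congr EFin.
by rewrite /r; field; rewrite gt_eqF.
Qed.

(** Uniform integrability of nonnegative functions, expressed by the positive part of [d - K]; this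
    form matches the error of [clip]. *)
Definition unif_int d := forall e : R, 0 < e ->
  exists2 K, 0 < K & forall i, avg (fun x => d i x - Num.min (d i x) K) <= e.

Lemma unif_int_avg d : unif_int d -> exists2 C : R, 0 < C & forall i, avg (d i) <= C.
Proof.
move=> /(_ 1 ltr01)[K K0 dK]; exists (K + 1) => [|i]; first exact: addr_gt0.
have -> : avg (d i) = avg (fun x => Num.min (d i x) K) +
    avg (fun x => d i x - Num.min (d i x) K).
  by rewrite -avgD; congr avg; apply/funext => x; rewrite addrC subrK.
apply: lerD (dK i); rewrite -[leRHS](avg_cst (N i)).
by apply: ler_avg => x; rewrite ge_min lexx orbT.
Qed.

(** By Markov, [d i >= C / e] has probability at most [e]. Off the corresponding internal set,
    [g i (w i)] is bounded by [C / e] for most [i] and therefore converges. *)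
Lemma dominated_lifts g d : unif_int d -> (forall i x, `|g i x| <= d i x) ->
  exists v, lifts g v.
Proof.
move=> /unif_int_avg[C C0 dC] gd.
exists (fun w => lim ((fun i => g i (w i)) @ nat_ultra)).
apply/ae_null => e e0; exists (fun i => [set x | C / e <= d i x]); split.
  move=> w /= ncvg; apply: contrapT => /ultraN dw; apply: ncvg.
  apply: (@bounded_ultra_cvg _ (C / e)); apply: filterS dw => i /negP.
  by rewrite -ltNge => /ltW; exact: le_trans.
apply: ulim_pr_le; apply: nearW => i.
have Ce : 0 < C / e by rewrite divr_gt0.
rewrite -(ler_pM2l Ce) divfK ?gt_eqF// (le_trans _ (dC i))//.
by apply: pr_markov => x; exact: le_trans (gd i x).
Qed.

(** Clipping at level [n + 1] reduces to the bounded case. As [n] grows, dominated convergence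
    handles the integrals, and uniform integrability makes the averages of the clipped functions
    approach those of [g] uniformly in [i]. *)
Lemma dominated_integral g v d l : unif_int d ->
  (forall i x, `|g i x| <= d i x) -> lifts g v ->
  (fun i => avg (g i)) @ nat_ultra --> l ->
  P.-integrable setT (EFin \o v) /\ (\int[P]_w (v w)%:E = l%:E)%E.
Proof.
move=> dui gd gv gl; have [C C0 dC] := unif_int_avg dui.
have mv := lifts_measurable gv.
have clipI n (h : ifun) u : lifts h u -> exists2 ln,
    (fun i => avg (fun x => clip n.+1%:R (h i x))) @ nat_ultra --> ln &
    (\int[P]_w (clip n.+1%:R (u w))%:E = ln%:E)%E.
  move=> hu.
  have cvgl : cvg ((fun i => avg (fun x => clip n.+1%:R (h i x))) @ nat_ultra).
    apply: (@bounded_ultra_cvg _ n.+1%:R); apply: nearW => i.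
    rewrite (le_trans (ler_norm_avg _))// -[leRHS](avg_cst (N i)).
    by apply: ler_avg => x; exact: norm_clip_le.
  exists (lim ((fun i => avg (fun x => clip n.+1%:R (h i x))) @ nat_ultra)).
    exact: cvgl.
  apply: (@lifts_integral_bounded (fun i x => clip n.+1%:R (h i x)) _ n.+1%:R).
  - by [].
  - by move=> i x; exact: norm_clip_le.
  - by move=> w; exact: norm_clip_le.
  - by apply: lifts_comp hu => y z; exact: clip_lip.
  - exact: cvgl.
have clip_cvg (x : R) : (fun n => (clip n.+1%:R x)%:E) @ \oo --> x%:E.
  apply: cvg_near_cst; near=> n; congr EFin; apply: clip_id.
  near: n; have [n xn] : exists n, `|x| <= n.+1%:R.
    exists (Num.bound `|x|).
    by rewrite (le_trans (ltW (archi_boundP (normr_ge0 x))))// ler_nat.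
  by exists n => // m /= nm; rewrite (le_trans xn)// ler_nat.
have mclip n (u : Omega -> R) : measurable_fun setT u ->
    measurable_fun setT (fun w => (clip n.+1%:R (u w))%:E).
  move=> mu; apply/measurable_EFinP; apply: measurable_maxr => //.
  exact: measurable_minr.
(* The clipped [|v|] rise to [|v|] and have integral at most [C], so monotone convergence gives the
   integrability on which dominated convergence rests. *)
have absv : (\int[P]_w `|(v w)%:E| <= C%:E)%E.
  pose u w := `|v w|.
  have mu : measurable_fun setT u by exact: measurableT_comp.
  have -> : (\int[P]_w `|(v w)%:E| =
      \int[P]_w limn (fun n => (clip n.+1%:R (u w))%:E))%E.
    by apply: eq_integral => w _; apply/esym/cvg_lim.
  have clip_ge0 n w : (0 <= (clip n.+1%:R (u w))%:E)%E.
    by rewrite lee_fin /clip le_max le_min /u normr_ge0 ler0n orbT.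
  have clip_mono w : {homo (fun n => (clip n.+1%:R (u w))%:E) :
      n m / (n <= m)%N >-> (n <= m)%E}.
    have cE n : clip n.+1%:R (u w) = Num.min n.+1%:R (u w).
      rewrite /clip max_r// le_min (@le_trans _ _ 0) ?oppr_le0 ?ler0n//=.
      by rewrite (@le_trans _ _ 0) ?oppr_le0 ?ler0n// /u.
    move=> n m nm; rewrite lee_fin !cE le_min !ge_min lexx orbT andbT.
    by rewrite ler_nat ltnS nm.
  rewrite monotone_convergence//; last by move=> n; exact: mclip.
  apply: lime_le.
    apply: ereal_nondecreasing_is_cvgn => n m nm; apply: ge0_le_integral => //.
    - exact: mclip.
    - exact: mclip.
    - by move=> w _; exact: clip_mono.
  apply: nearW => n.
  have gu : lifts (fun i x => `|g i x|) u.
    by apply: lifts_comp gv => y z; exact: ler_dist_dist.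
  have [ln cl ->] := clipI n _ _ gu; rewrite lee_fin.
  apply: (cvgr_to_le cl); apply: nearW => i.
  apply: le_trans (dC i); apply: ler_avg => x; apply: le_trans (gd i x).
  rewrite -[leRHS]normr_id; apply: le_trans (ler_norm _) _.
  exact: norm_clip.
have iv : P.-integrable setT (EFin \o v).
  apply/integrableP; split; first exact/measurable_EFinP.
  exact: le_lt_trans absv (ltry _).
split=> //.
have mEv : measurable_fun setT (EFin \o v) by exact/measurable_EFinP.
have ae1 : \forall w \ae P, setT w ->
    (fun n => (clip n.+1%:R (v w))%:E) @ \oo --> (EFin \o v) w.
  by apply: nearW => w _; exact: clip_cvg.
have ae2 : \forall w \ae P, forall n, setT w ->
    (`|(clip n.+1%:R (v w))%:E| <= `|(v w)%:E|)%E.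
  by apply: nearW => w n _; rewrite lee_fin norm_clip.
have [_ _ DC] := dominated_convergence measurableT (fun n => mclip n _ mv) mEv
  ae1 (integrable_abse iv) ae2.
(* By [DC] the integrals of the clipped functions tend to the integral of [v]; it remains to see
   that they also tend to [l]. *)
apply: (cvg_unique _ DC) => //.
have /choice[ln lnP] : forall n, exists ln : R,
    (fun i => avg (fun x => clip n.+1%:R (g i x))) @ nat_ultra --> ln /\
    (\int[P]_w (clip n.+1%:R (v w))%:E = ln%:E)%E.
  by move=> n; have [ln ? ?] := clipI n _ _ gv; exists ln.
rewrite (_ : [sequence _]_n = EFin \o ln); last first.
  by apply/funext => n; exact: (lnP n).2.
apply: cvg_EFin; first exact: nearW.
apply/cvgrPdist_le => e /dui[K K0 dK].
exists (Num.bound K) => // n /= Kn.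
have cvB : (fun i => `|avg (g i) - avg (fun x => clip n.+1%:R (g i x))|)
    @ nat_ultra --> `|l - ln n|.
  by apply: cvg_norm; apply: cvgB => //; exact: (lnP n).1.
apply: (cvgr_to_le cvB); apply: nearW => i /=.
rewrite -avgB (le_trans (ler_norm_avg _))// (le_trans _ (dK i))//.
apply: ler_avg => x; apply: le_trans (clip_tail _ (gd i x)) _ => //.
have {}Kn : K <= n.+1%:R.
  rewrite (le_trans (ltW (archi_boundP (ltW K0))))// ler_nat.
  exact: leq_trans Kn _.
rewrite lerD2l lerN2 le_min ge_min lexx/= ge_min.
by rewrite Kn orbT.
Unshelve. all: by end_near.
Qed.
End dominated.

(** * The limit operator *)

Section limit_operator.
Variables (R : realType) (N : nat -> nat).
Local Notation ifun := (forall i, vert (N i) -> R).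
Local Notation Omega := (uprod R N).
Local Notation P := (loebP R N).
Variable a : forall i, vert (N i) -> vert (N i) -> R.
Hypothesis a_ge0 : forall i x y, 0 <= @a i x y.
Hypothesis a_sym : forall i x y, @a i x y = @a i y x.
Implicit Types (h : ifun) (v : Omega -> R) (M : R).

(** In the application [a i] is the adjacency matrix of [G i] divided by [f]; [deg] is the image of
    the constant 1 under the operator. *)
Definition kop i (h : vert (N i) -> R) x := \sum_y a x y * h y.

Definition deg : ifun := fun i x => \sum_y a x y.

Hypothesis deg_ui : unif_int deg.

Lemma deg_ge0 i x : 0 <= deg (i := i) x.
Proof. exact: sumr_ge0. Qed.

Lemma kop_lin i (s t : R) (h k : vert (N i) -> R) x :
  kop (fun y => s * h y + t * k y) x = s * kop h x + t * kop k x.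
Proof.
rewrite /kop !mulr_sumr -big_split; apply: eq_bigr => y _ /=.
by rewrite mulrDr !mulrA ![a x y * _]mulrC.
Qed.

Lemma ler_norm_kop i (h : vert (N i) -> R) x :
  `|kop h x| <= kop (fun y => `|h y|) x.
Proof.
apply: le_trans (ler_norm_sum _ _ _) _; apply: ler_sum => y _.
by rewrite normrM (ger0_norm (a_ge0 _ _)).
Qed.

Lemma kop_le i (h : vert (N i) -> R) M x : (forall y, `|h y| <= M) ->
  `|kop h x| <= M * deg x.
Proof.
move=> hM; apply: le_trans (ler_norm_kop _ _) _; rewrite mulr_sumr.
by apply: ler_sum => y _; rewrite mulrC ler_wpM2r.
Qed.

Lemma kop_sym i (h k : vert (N i) -> R) :
  avg (fun x => kop h x * k x) = avg (fun x => kop k x * h x).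
Proof.
rewrite /avg; congr (_ / _); under eq_bigr do rewrite mulr_suml.
rewrite exchange_big; apply: eq_bigr => x _.
by rewrite mulr_suml; apply: eq_bigr => y _; rewrite a_sym mulrAC.
Qed.

Lemma deg_uiZ M : 0 < M -> unif_int (fun i x => M * deg (i := i) x).
Proof.
move=> M0 e e0; have [|K K0 dK] := deg_ui (e := e / M); first exact: divr_gt0.
exists (M * K) => [|i]; first exact: mulr_gt0.
have -> : avg (fun x => M * deg (i := i) x - Num.min (M * deg x) (M * K)) =
    M * avg (fun x => deg (i := i) x - Num.min (deg x) K).
  by rewrite -avgZ; congr avg; apply/funext => x; rewrite -minr_pMr ?ltW// mulrBr.
by rewrite -ler_pdivlMl// mulrC.
Qed.

Lemma deg_lifts : exists D, lifts deg D.
Proof.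
apply: (dominated_lifts deg_ui) => i x.
by rewrite ger0_norm ?deg_ge0.
Qed.

(* Symmetry gives avg |kop h| <= avg (|h| * deg), and |h| * deg has ultralimit 0
   and is dominated by M * deg. *)
Lemma kop_ae0 h M : 0 < M -> (forall i x, `|h i x| <= M) ->
  lifts h (fun=> 0) -> lifts (fun i => kop (h i)) (fun=> 0).
Proof.
move=> M0 hM h0; have Mui := deg_uiZ M0; have [D degD] := deg_lifts.
pose g i x := `|h i x| * deg x.
have gM i x : `|g i x| <= M * deg x.
  by rewrite normrM normr_id (ger0_norm (deg_ge0 x)) ler_wpM2r ?deg_ge0.
have g0 : lifts g (fun=> 0).
  apply: filterS2 h0 degD => w h0 dD; rewrite -(mul0r (D w)).
  by apply: cvgM dD; rewrite -(normr0 R); exact: cvg_norm.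
have avg_g0 : (fun i => avg (g i)) @ nat_ultra --> (0 : R).
  have [C C0 dC] := unif_int_avg Mui.
  have gl : cvg ((fun i => avg (g i)) @ nat_ultra).
    apply: (@bounded_ultra_cvg _ C); apply: nearW => i.
    apply: le_trans (ler_norm_avg _) _; apply: le_trans (dC i).
    by apply: ler_avg => x; exact: gM.
  have [_ ] := dominated_integral Mui gM g0 gl.
  by rewrite integral0 => -[l0]; rewrite [in X in _ --> X]l0.
pose f i x := `|kop (h i) x|.
have fM i x : `|f i x| <= M * deg x by rewrite normr_id; exact: kop_le.
have [v fv] := dominated_lifts Mui fM.
have fv' : lifts f (fun w => `|v w|).
  have := lifts_comp (phi := fun y : R => `|y|) _ fv; rewrite /comp/=.
  have -> : (fun i x => `|f i x|) = f.
    by apply: functional_extensionality_dep => i; apply/funext => x; exact: normr_id.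
  by apply=> y z; exact: ler_dist_dist.
have avg_f0 : (fun i => avg (f i)) @ nat_ultra --> (0 : R).
  apply: (squeeze_cvgr _ (cvg_cst 0) avg_g0); apply: nearW => i.
  rewrite avg_ge0 => [|x]; last exact: normr_ge0.
  (* The factor 1 gives the form required by [kop_sym], which carries the operator from [|h i|] to
     the constant 1, where it yields [deg]. *)
  apply: (@le_trans _ _ (avg (fun x => kop (fun y => `|h i y|) x * 1))).
    by apply: ler_avg => x; rewrite mulr1; exact: ler_norm_kop.
  rewrite kop_sym; apply: ler_avg => x; rewrite mulrC ler_wpM2l//.
  by rewrite /kop /deg; apply: ler_sum => y _; rewrite mulr1.
have [_ v0] := dominated_integral Mui fM fv' avg_f0.
have mv := lifts_measurable fv'.
have /ae_eq_integral_abs : (\int[P]_(w in setT) `|(`|v w|)%:E| = 0)%E.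
  by rewrite -[RHS]v0; apply: eq_integral => w _; rewrite /= normr_id.
move=> /(_ measurableT _); rewrite measurable_EFinP => /(_ mv) v'0.
apply: filterS2 fv' v'0 => w fw /(_ I) [v0w]; rewrite v0w in fw.
exact/norm_cvg0P.
Qed.

Definition bounded_lift v h :=
  (exists2 M, 0 < M & forall i x, `|h i x| <= M) /\ lifts h v.

(* [lim] is arbitrary on the null set where there is no convergence. *)
Definition limop v : Omega -> R :=
  if pselect (exists h, bounded_lift v h) is left vh then
    fun w => lim ((fun i => kop (projT1 (cid vh) i) (w i)) @ nat_ultra)
  else fun=> 0.

(** Two bounded lifts of [v] differ by a bounded lift of 0, which the operators send to a lift of 0
    by [kop_ae0]. Hence [limop v] is independent, up to a null set, of the lift chosen in its
    definition. *)
Lemma limop_lifts v h : bounded_lift v h -> lifts (fun i => kop (h i)) (limop v).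
Proof.
move=> hv; rewrite /limop; case: pselect => [vh|[]]; last by exists h.
case: cid => k [[K K0 kK] kv] /=; case: hv => -[M M0 hM] hv.
have [u ku] : exists u, lifts (fun i => kop (k i)) u.
  by apply: (dominated_lifts (deg_uiZ K0)) => i x; exact: kop_le.
have : lifts (fun i => kop (fun y => 1 * h i y + (- 1) * k i y)) (fun=> 0).
  apply: (@kop_ae0 (fun i y => 1 * h i y + (- 1) * k i y) (M + K)).
  - exact: addr_gt0.
  - move=> i x; rewrite mul1r mulN1r (le_trans (ler_normB _ _))//.
    exact: lerD.
  apply: filterS2 hv kv => w hw kw; rewrite -(subrr (v w)).
  under eq_fun do rewrite mul1r mulN1r.
  exact: cvgB.
apply: filterS2 ku => w kw hk0.
rewrite (cvg_lim _ kw)// -[u w]add0r.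
have -> : (fun i => kop (h i) (w i)) =
    (fun i => kop (fun y => 1 * h i y + (- 1) * k i y) (w i) + kop (k i) (w i)).
  by apply/funext => i; rewrite kop_lin mul1r mulN1r subrK.
exact: cvgD.
Qed.

Lemma Linf_lift v : Linf P v -> exists h, bounded_lift v h.
Proof.
move=> [mv [M vM]].
have M0 : 0 < Num.max M 1 by rewrite lt_max ltr01 orbT.
have [|h [hM hv]] := lifts_bounded (ltW M0) mv.
  by apply: filterS vM => w /le_trans; apply; rewrite le_max lexx.
by exists h; split=> //; exists (Num.max M 1).
Qed.

(** The ultralimit [D] of the degrees satisfies [|vA| <= m D] a.e. when [|v| <= m] a.e., so the
    integral of [D] bounds the norm from [L^oo] to [L^1]. *)
Lemma limop_Poperator : Poperator P limop.
Proof.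
have [D degD] := deg_lifts; split.
- by move=> v /Linf_lift[h /limop_lifts/lifts_measurable].
- move=> v w /Linf_lift[h [hM hv]] _ vw.
  have hw : lifts h w by apply: filterS2 hv vw => z hz <-.
  by apply: (@lifts_unique _ _ (fun i => kop (h i))); exact: limop_lifts.
- move=> s t v w /Linf_lift[h hv] /Linf_lift[k kw].
  have hk : bounded_lift (fun y => s * v y + t * w y)
      (fun i x => s * h i x + t * k i x).
    case: hv kw => -[M M0 hM] hv [[K K0 kK] kw]; split.
      exists (`|s| * M + `|t| * K + 1) => [|i x].
        by rewrite ltr_wpDl// addr_ge0// mulr_ge0// ltW.
      rewrite (le_trans (ler_normD _ _))// !normrM ler_wpDr//.
      by apply: lerD; apply: ler_wpM2l.
    by apply: filterS2 hv kw => z hz kz; apply: cvgD; apply: cvgMr.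
  apply: (lifts_unique (limop_lifts hk)).
  apply: filterS2 (limop_lifts hv) (limop_lifts kw) => z hz kz.
  under eq_fun do rewrite kop_lin.
  by apply: cvgD; apply: cvgMr.
have [C0 C0_gt0 dC0] := unif_int_avg deg_ui.
have dl : cvg ((fun i => avg (deg (i := i))) @ nat_ultra).
  apply: (@bounded_ultra_cvg _ C0); apply: nearW => i.
  by rewrite ger0_norm ?avg_ge0//; exact: deg_ge0.
have degE i x : `|deg (i := i) x| <= deg x by rewrite ger0_norm ?deg_ge0.
have [iD ID] := dominated_integral deg_ui degE degD dl.
set l := lim _ in ID.
have D0 : \forall w \ae P, 0 <= D w.
  apply: filterS degD => w dw; apply: (cvgr_to_ge dw); apply: nearW => i.
  exact: deg_ge0.
have iD' : (\int[P]_w `|(D w)%:E| = l%:E)%E.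
  rewrite -ID; apply: ae_eq_integral => //.
  - by apply: measurableT_comp => //; exact: measurable_int iD.
  - exact: measurable_int iD.
  - by apply: filterS D0 => w D0 _; rewrite /= ger0_norm.
exists l => v lv; rewrite Lnorm1.
have [mv [B vB]] := lv; have [h hv] := Linf_lift lv.
have mA := lifts_measurable (limop_lifts hv).
set M := Lnorm P +oo%E _.
have vM : \forall w \ae P, (`|v w|%:E <= M)%E.
  rewrite /M unlock [X in (0 < X)%E]loebT lte01.
  exact: ess_sup_ge.
have M0 : (0 <= M)%E by exact: Lnorm_ge0.
(* This makes the essential supremum [M] a real number [m]; the lift [k] below is bounded by that
   sharp value instead of [B]. *)
have : (M <= (Num.max B 0)%:E)%E.
  rewrite /M unlock [X in (0 < X)%E]loebT lte01.
  apply/ess_supP; apply: filterS vB => w vB /=.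
  by rewrite lee_fin le_max vB.
move: vM M0; case: M => [m| |] // vm m0 _.
have m0' : 0 <= m by [].
have [k [km kv]] := lifts_bounded m0' mv vm.
have kl : bounded_lift v k.
  split=> //; exists (m + 1) => [|i x]; first by rewrite ltr_wpDl.
  by rewrite (le_trans (km i x))// lerDl.
have Am : \forall w \ae P, `|limop v w| <= m * D w.
  apply: filterS2 (limop_lifts kl) degD => w kw dw.
  have c1 : (fun i => `|kop (k i) (w i)|) @ nat_ultra --> `|limop v w|.
    exact: cvg_norm.
  have c2 : (fun i => m * deg (w i)) @ nat_ultra --> m * D w by exact: cvgMr.
  by apply: (ultra_le_lim c1 c2); apply: nearW => i; exact: kop_le.
have mDn : measurable_fun setT (fun w => `|(D w)%:E|)%E.
  by apply: measurableT_comp => //; exact: measurable_int iD.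
rewrite muleC -iD' -ge0_integralZl//.
apply: ae_ge0_le_integral => //.
- by apply: measurableT_comp => //; exact/measurable_EFinP.
- by move=> w _; rewrite mule_ge0.
- exact: measurable_funeM.
apply: filterS2 Am D0 => w Am D0 _.
by rewrite /= (ger0_norm D0) lee_fin.
Qed.

(** The identity [kop_sym] passes to the limit because the products on the vertex sets are dominated
    by [M * K * deg]. *)
Lemma limop_self_adjoint : self_adjoint P limop.
Proof.
move=> v w /Linf_lift[h hv] /Linf_lift[k kw].
have [[M M0 hM] [K K0 kK]] := (hv.1, kw.1).
pose g i x := kop (h i) x * k i x.
pose g' i x := kop (k i) x * h i x.
have MK0 : 0 < M * K by exact: mulr_gt0.
have gle i x : `|g i x| <= M * K * deg x.
  rewrite normrM mulrAC; apply: ler_pM => //; exact: kop_le.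
have gle' i x : `|g' i x| <= M * K * deg x.
  by rewrite normrM (mulrC M) mulrAC; apply: ler_pM => //; exact: kop_le.
have gl : lifts g (fun z => limop v z * w z).
  by apply: filterS2 (limop_lifts hv) kw.2 => z; exact: cvgM.
have gl' : lifts g' (fun z => limop w z * v z).
  by apply: filterS2 (limop_lifts kw) hv.2 => z; exact: cvgM.
have [C C0 dC] := unif_int_avg (deg_uiZ MK0).
have cg : cvg ((fun i => avg (g i)) @ nat_ultra).
  apply: (@bounded_ultra_cvg _ C); apply: nearW => i.
  apply: le_trans (ler_norm_avg _) _; apply: le_trans (dC i).
  by apply: ler_avg => x; exact: gle.
rewrite /pairing (dominated_integral (deg_uiZ MK0) gle gl cg).2.
apply/esym; apply: (dominated_integral (deg_uiZ MK0) gle' gl' _).2.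
have -> : (fun i => avg (g' i)) = (fun i => avg (g i)).
  by apply/funext => i; exact: kop_sym.
exact: cg.
Qed.

(** For [v >= 0] the absolute value of a lift is again a lift of [v], and a nonnegative kernel keeps
    it nonnegative. *)
Lemma limop_positive : positivity_preserving P limop.
Proof.
move=> v /Linf_lift[h [[M M0 hM] hv]] v0.
have hv' : bounded_lift v (fun i x => `|h i x|).
  split; first by exists M => // i x; rewrite normr_id.
  by apply: filterS2 hv v0 => w hw vw; rewrite -(ger0_norm vw); exact: cvg_norm.
apply: filterS (limop_lifts hv') => w hw.
apply: (cvgr_to_ge hw); apply: nearW => i.
by apply: sumr_ge0 => y _; rewrite mulr_ge0.
Qed.

Lemma limop_graphop : graphop P limop.
Proof.
split; [exact: limop_Poperator | exact: limop_self_adjoint |].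
exact: limop_positive.
Qed.

End limit_operator.

(** * Euclidean distance and the Hausdorff distance *)

(* The unqualified name is the extended distance of MathComp-Analysis. *)
Local Notation edist := Defs.edist.

Section euclid.
Variables (R : realType) (m : nat).
Implicit Types (x y z : 'rV[R]_m) (U : set 'rV[R]_m) (e : R).

(** Cauchy-Schwarz, by summing [2 a b <= t a^2 + b^2 / t] at the optimal [t = sqrt B / sqrt A]; the
    case of a zero sum is separate, since [t] and its inverse divide by these roots. *)
Lemma sum_mul_le_sqrt (n : nat) (a b : 'I_n -> R) :
  \sum_i a i * b i <= Num.sqrt (\sum_i a i ^+ 2) * Num.sqrt (\sum_i b i ^+ 2).
Proof.
set A := \sum_i a i ^+ 2; set B := \sum_i b i ^+ 2.
have A0 : 0 <= A by apply: sumr_ge0 => i _; exact: sqr_ge0.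
have B0 : 0 <= B by apply: sumr_ge0 => i _; exact: sqr_ge0.
have [A_eq0|A_neq0] := eqVneq A 0.
  rewrite big1 ?mulr_ge0// => i _.
  have /eqP := A_eq0; rewrite psumr_eq0 => [/allP/(_ i)|j _]; last exact: sqr_ge0.
  by rewrite mem_index_enum sqrf_eq0 => /(_ isT)/eqP ->; rewrite mul0r.
have [B_eq0|B_neq0] := eqVneq B 0.
  rewrite big1 ?mulr_ge0// => i _.
  have /eqP := B_eq0; rewrite psumr_eq0 => [/allP/(_ i)|j _]; last exact: sqr_ge0.
  by rewrite mem_index_enum sqrf_eq0 => /(_ isT)/eqP ->; rewrite mulr0.
have sA : 0 < Num.sqrt A by rewrite sqrtr_gt0 lt_def A_neq0.
have sB : 0 < Num.sqrt B by rewrite sqrtr_gt0 lt_def B_neq0.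
have AE : A = Num.sqrt A ^+ 2 by rewrite sqr_sqrtr.
have BE : B = Num.sqrt B ^+ 2 by rewrite sqr_sqrtr.
pose t := Num.sqrt B / Num.sqrt A.
have t0 : 0 < t by rewrite divr_gt0.
have ab i : a i * b i <= 2^-1 * (t * a i ^+ 2 + t^-1 * b i ^+ 2).
  have tn0 : t != 0 by rewrite gt_eqF.
  rewrite -subr_ge0.
  have -> : 2^-1 * (t * a i ^+ 2 + t^-1 * b i ^+ 2) - a i * b i =
      2^-1 * t^-1 * (t * a i - b i) ^+ 2 by field.
  by rewrite mulr_ge0 ?sqr_ge0// mulr_ge0// invr_ge0 ltW.
apply: le_trans (ler_sum _ (fun i _ => ab i)) _.
rewrite -mulr_sumr big_split -!mulr_sumr -/A -/B /t.
move: sA sB AE BE; set sa := Num.sqrt A; set sb := Num.sqrt B => sA sB AE BE.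
rewrite AE BE le_eqVlt; apply/orP; left; apply/eqP => /=; field.
by rewrite !gt_eqF.
Qed.

Lemma edist_ge0 x y : 0 <= edist x y.
Proof. exact: sqrtr_ge0. Qed.

Lemma edistxx x : edist x x = 0.
Proof.
by rewrite /edist big1 ?sqrtr0// => i _; rewrite subrr expr0n.
Qed.

Lemma edist_sym x y : edist x y = edist y x.
Proof.
by rewrite /edist; congr Num.sqrt; apply: eq_bigr => i _; rewrite -sqrrN opprB.
Qed.

Lemma edist_triangle x y z : edist x z <= edist x y + edist y z.
Proof.
rewrite -(@ler_pXn2r _ 2)// ?nnegrE ?addr_ge0 ?edist_ge0//.
rewrite sqrrD /edist !sqr_sqrtr; last 3 first.
- by apply: sumr_ge0 => i _; exact: sqr_ge0.
- by apply: sumr_ge0 => i _; exact: sqr_ge0.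
- by apply: sumr_ge0 => i _; exact: sqr_ge0.
have h := sum_mul_le_sqrt (fun i => x ord0 i - y ord0 i) (fun i => y ord0 i - z ord0 i).
have -> : \sum_(i < m) (x ord0 i - z ord0 i) ^+ 2 =
    \sum_(i < m) (x ord0 i - y ord0 i) ^+ 2 +
    (\sum_(i < m) (x ord0 i - y ord0 i) * (y ord0 i - z ord0 i)) *+ 2 +
    \sum_(i < m) (y ord0 i - z ord0 i) ^+ 2.
  rewrite -sumrMnl -!big_split; apply: eq_bigr => i _ /=.
  rewrite -mulr_natr; ring.
by rewrite lerD2r lerD2l lerMn2r h.
Qed.

Lemma eopen_enbhd U e : eopen (enbhd U e).
Proof.
move=> x [u Uu xu]; exists (e - edist x u); first by rewrite subr_gt0.
move=> y /= xy; exists u => //; apply: le_lt_trans (edist_triangle y x u) _.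
by rewrite edist_sym -ltrBrDr.
Qed.

Lemma borel_enbhd U e : borel (enbhd U e).
Proof. by apply: sub_sigma_algebra; exact: eopen_enbhd. Qed.

Lemma sub_enbhd U V e e' : U `<=` V -> e <= e' -> enbhd U e `<=` enbhd V e'.
Proof.
by move=> UV ee' x [u Uu xu]; exists u; [exact: UV|exact: lt_le_trans ee'].
Qed.

Lemma enbhd_enbhd U e e' : enbhd (enbhd U e) e' `<=` enbhd U (e + e').
Proof.
move=> x [y [u Uu yu] xy]; exists u => //.
by rewrite addrC; apply: le_lt_trans (edist_triangle x y u) _; exact: ltrD.
Qed.

Lemma edist_cvg0 (x : nat -> 'rV[R]_m) y :
  (forall j, (fun i => x i ord0 j) @ nat_ultra --> y ord0 j) ->
  (fun i => edist (x i) y) @ nat_ultra --> (0 : R).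
Proof.
move=> xy; rewrite -(edistxx y) /edist.
apply: continuous_cvg; first exact: sqrt_continuous.
apply: cvg_big => [|j _]; first exact: add_continuous.
have c : (fun i => x i ord0 j - y ord0 j) @ nat_ultra --> y ord0 j - y ord0 j.
  by apply: cvgB; [exact: xy|exact: cvg_cst].
by rewrite expr2; apply: cvgM.
Qed.

End euclid.

(** * The Levy-Prokhorov distance of set functions and the induced Hausdorff distance *)

Section levy_prokhorov.
Variables (R : realType) (m : nat).
Implicit Types (mu nu : set 'rV[R]_m -> \bar R) (e : R).

Definition LPclose e mu nu := forall U, borel U ->
  (mu U <= nu (enbhd U e) + e%:E)%E /\ (nu U <= mu (enbhd U e) + e%:E)%E.

Lemma dLP_le e mu nu : 0 < e -> LPclose e mu nu -> dLP mu nu <= e.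
Proof.
by move=> e0 ec; apply: ge_inf => //; exists 0 => x [/ltW].
Qed.

Lemma dLP_ge0 mu nu : 0 <= dLP mu nu.
Proof.
rewrite /dLP; set S := [set _ | _].
have [->|S0] := eqVneq S set0; first by rewrite inf0.
by apply: lb_le_inf; [exact/set0P|move=> x [/ltW]].
Qed.

(** For such set functions the radius 1 is admissible, so the infimum in [dLP] is over a nonempty
    set and the suprema in [dH] are over bounded sets; default values are thus avoided. *)
Definition unit_valued mu := forall U, (0 <= mu U <= 1)%E.

Lemma LPclose1 mu nu : unit_valued mu -> unit_valued nu -> LPclose 1 mu nu.
Proof.
move=> mu1 nu1 U _; have /andP[_ mU] := mu1 U; have /andP[_ nU] := nu1 U.
have /andP[m0 _] := mu1 (enbhd U 1); have /andP[n0 _] := nu1 (enbhd U 1).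
by split; rewrite (le_trans _ (leeDr _ _)).
Qed.

Lemma dLP_le1 mu nu : unit_valued mu -> unit_valued nu -> dLP mu nu <= 1.
Proof. by move=> mu1 nu1; apply: dLP_le (LPclose1 mu1 nu1). Qed.

(** The radius [e'] is kept because enlarging it to [e] takes monotonicity of the set functions, as
    in [LPclose_unif_mono]. *)
Lemma dLP_lt e mu nu : unit_valued mu -> unit_valued nu -> dLP mu nu < e ->
  exists2 e', 0 < e' < e & LPclose e' mu nu.
Proof.
move=> mu1 nu1 /inf_lt[|e' [e'0 ec] ee'].
  by exists 1; split=> //; exact (LPclose1 mu1 nu1).
by exists e' => //; rewrite e'0.
Qed.

Implicit Types X Y : set (set 'rV[R]_m -> \bar R).

Definition unit_family X := X !=set0 /\ forall mu, X mu -> unit_valued mu.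


Let infl_le Y x y : Y y -> inf [set dLP x y | y in Y] <= dLP x y.
Proof.
by move=> Yy; apply: ge_inf; [exists 0 => _ [z _ <-]; exact: dLP_ge0|exists y].
Qed.

Let infr_le X x y : X x -> inf [set dLP x y | x in X] <= dLP x y.
Proof.
by move=> Xx; apply: ge_inf; [exists 0 => _ [z _ <-]; exact: dLP_ge0|exists x].
Qed.

Lemma dH_le e X Y : X !=set0 -> Y !=set0 ->
  (forall x, X x -> exists2 y, Y y & dLP x y <= e) ->
  (forall y, Y y -> exists2 x, X x & dLP x y <= e) -> dH X Y <= e.
Proof.
move=> [x0 Xx0] [y0 Yy0] XY YX; rewrite /dH ge_max; apply/andP; split.
  apply: ge_sup; first by exists (inf [set dLP x0 y | y in Y]), x0.
  move=> _ [x Xx <-]; have [y Yy] := XY x Xx.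
  exact: le_trans (infl_le _ Yy).
apply: ge_sup; first by exists (inf [set dLP x y0 | x in X]), y0.
move=> _ [y Yy <-]; have [x Xx] := YX y Yy.
exact: le_trans (infr_le _ Xx).
Qed.

Lemma dH_lt e X Y : unit_family X -> unit_family Y -> dH X Y < e ->
  (forall x, X x -> exists2 y, Y y & dLP x y < e) /\
  (forall y, Y y -> exists2 x, X x & dLP x y < e).
Proof.
move=> [[x0 Xx0] X1] [[y0 Yy0] Y1]; rewrite /dH gt_max => /andP[le re]; split.
- move=> x Xx; have : inf [set dLP x y | y in Y] < e.
    apply: le_lt_trans le; apply: ub_le_sup; last by exists x.
    exists 1 => _ [z Xz <-]; apply: le_trans (infl_le _ Yy0) _.
    by apply: dLP_le1; [exact: X1|exact: Y1].
  move=> /inf_lt[|_ [y Yy <-]]; last by exists y.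
  by exists (dLP x y0), y0.
- move=> y Yy; have : inf [set dLP x y | x in X] < e.
    apply: le_lt_trans re; apply: ub_le_sup; last by exists y.
    exists 1 => _ [z Yz <-]; apply: le_trans (infr_le _ Xx0) _.
    by apply: dLP_le1; [exact: X1|exact: Y1].
  move=> /inf_lt[|_ [x Xx <-]]; last by exists x.
  by exists (dLP x0 y), x0.
Qed.

Lemma dH_bounds X Y : unit_family X -> unit_family Y -> 0 <= dH X Y <= 1.
Proof.
move=> [[x0 Xx0] X1] [[y0 Yy0] Y1]; apply/andP; split.
  rewrite /dH le_max; apply/orP; left.
  apply: le_trans (ub_le_sup _ _); last by exists x0.
    by apply: lb_le_inf; [exists (dLP x0 y0), y0|move=> _ [z _ <-]; exact: dLP_ge0].
  exists 1 => _ [z Xz <-]; apply: le_trans (infl_le _ Yy0) _.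
  by apply: dLP_le1; [exact: X1|exact: Y1].
apply: dH_le; [by exists x0|by exists y0| |].
  by move=> x Xx; exists y0 => //; apply: dLP_le1; [exact: X1|exact: Y1].
by move=> y Yy; exists x0 => //; apply: dLP_le1; [exact: X1|exact: Y1].
Qed.

End levy_prokhorov.

(** * Laws of ultralimits *)

Section laws.
Variables (R : realType) (N : nat -> nat).
Local Notation Omega := (uprod R N).
Local Notation P := (loebP R N).

Lemma law_unif n m (X : vert n -> 'rV[R]_m) U :
  law (unif R n) X U = (pr R (X @^-1` U))%:E.
Proof. exact: unifE. Qed.

Lemma loeb_le1 (S : set Omega) : (loeb S <= 1)%E.
Proof.
rewrite /loeb; case: pselect => // SA; rewrite lee_fin -(ulim_prT R N).
by apply: le_ulim_pr; apply: nearW.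
Qed.

Lemma law_unif_unit n m (X : vert n -> 'rV[R]_m) :
  unit_valued (law (unif R n) X).
Proof. by move=> U; rewrite law_unif !lee_fin pr_ge0 pr_le1. Qed.

Lemma law_loeb_unit m (X : Omega -> 'rV[R]_m) : unit_valued (law P X).
Proof. by move=> U; rewrite /law [X in (0 <= X)%E]/= loeb_le1 loeb_ge0. Qed.

Lemma LPclose_unif_mono m n n' (X : vert n -> 'rV[R]_m) (Y : vert n' -> 'rV[R]_m)
    (e e' : R) : e <= e' ->
  LPclose e (law (unif R n) X) (law (unif R n') Y) ->
  LPclose e' (law (unif R n) X) (law (unif R n') Y).
Proof.
move=> ee' XY U /XY; rewrite !law_unif -!EFinD !lee_fin => -[h1 h2]; split.
  apply: le_trans h1 _; apply: lerD => //; apply: le_pr => x.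
  exact: sub_enbhd.
apply: le_trans h2 _; apply: lerD => //; apply: le_pr => x.
exact: sub_enbhd.
Qed.

(** The preimage of a set under [X] or [X'] is contained in the preimage of its [d]-neighbourhood
    under the other, which adds [d] to the radius. *)
Lemma LPclose_unif_perturb m n n' (X X' : vert n -> 'rV[R]_m)
    (Y : vert n' -> 'rV[R]_m) (e d : R) :
  (forall x, edist (X x) (X' x) < d) ->
  LPclose e (law (unif R n) X) (law (unif R n') Y) -> 0 <= d ->
  LPclose (e + d) (law (unif R n) X') (law (unif R n') Y).
Proof.
move=> XX' XY d0 U bU; have [h1 _] := XY _ (borel_enbhd U d).
have [_ h2] := XY _ bU.
move: h1 h2; rewrite !law_unif -!EFinD !lee_fin => h1 h2; split.
  apply: (@le_trans _ _ (pr R (X @^-1` enbhd U d))).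
    apply: le_pr => x Ux; exists (X' x) => //; exact: XX'.
  apply: le_trans h1 _; apply: lerD; last by rewrite lerDl.
  by apply: le_pr => x /enbhd_enbhd; apply: sub_enbhd => //; rewrite addrC.
apply: le_trans h2 _; apply: lerD; last by rewrite lerDl.
apply: le_pr => x Ux; apply: enbhd_enbhd; exists (X x) => //.
by rewrite edist_sym; exact: XX'.
Qed.

Definition rv_lifts m (X : forall i, vert (N i) -> 'rV[R]_m)
    (Y : Omega -> 'rV[R]_m) :=
  \forall w \ae P, (fun i => edist (X i (w i)) (Y w)) @ nat_ultra --> (0 : R).

Lemma ae_null_setD (S T : set Omega) :
  (\forall w \ae P, S w -> T w) -> null (S `\` T).
Proof. by move=> /ae_null; apply: sub_null => w [Sw Tw] /(_ Sw). Qed.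

(** It suffices to treat open [O]. For almost every [w], [Y w] lies in [O] exactly when, for some
    [n], the ball of radius [1/(n+1)] about [X i (w i)] lies in [O] for most [i]; this describes a
    countable union of internal sets. *)
Lemma rv_lifts_measurable m (X : forall i, vert (N i) -> 'rV[R]_m) Y U :
  rv_lifts X Y -> borel U -> measurable (Y @^-1` U).
Proof.
move=> XY; suff : @borel R m `<=` [set V | measurable (Y @^-1` V)] by apply.
apply: smallest_sub.
  have := sigma_algebra_image Y (@sigma_algebra_measurable _ Omega).
  by rewrite /image_set_system; under eq_set do rewrite setTI.
move=> O oO /=.
pose A n i := [set x | [set y | edist (X i x) y < n.+1%:R^-1] `<=` O].
apply: (@ae_measurable _ _ _ (\bigcup_n internal (A n))).
  by apply: bigcup_measurable => n _; exact: measurable_internal.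
apply: filterS XY => w Xw /=; split.
  move=> /oO[e e0 eO].
  (* A ball of radius [e / 2] about a point within [e / 2] of [Y w] stays in the ball of radius [e]
     about [Y w]. *)
  have [n ne] := exists_natSinv_lt (divr_gt0 e0 (ltr0n R 2)); exists n => //.
  have e20 : 0 < e / 2 by rewrite divr_gt0.
  apply: filterS (cvgr_lt _ Xw _ e20) => i Xi y /= Xy; apply: eO => /=.
  apply: le_lt_trans (edist_triangle _ (X i (w i)) _) _.
  rewrite edist_sym; have := lt_trans Xy ne; lra.
move=> [n _ An]; have n0 : 0 < (n.+1%:R : R)^-1 by rewrite invr_gt0.
have [i [Ai Xi]] := filter_ex (filterI An (cvgr_lt _ Xw _ n0)).
exact: Ai.
Qed.

(** Almost everywhere, [X i (w i)] is within [e' - e] of [Y w] for most [i], so events for [Y] and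
    for the [X i] compare after an enlargement by this slack. *)
Lemma LPclose_lim m n (Z : vert n -> 'rV[R]_m)
    (X : forall i, vert (N i) -> 'rV[R]_m) Y (e e' : R) :
  rv_lifts X Y -> e < e' ->
  (\forall i \near nat_ultra,
    LPclose e (law (unif R n) Z) (law (unif R (N i)) (X i))) ->
  LPclose e' (law (unif R n) Z) (law P Y).
Proof.
move=> XY ee' ZX U bU.
have d0 : 0 < e' - e by rewrite subr_gt0.
have [B YB] := rv_lifts_measurable XY bU.
have [B' YB'] := rv_lifts_measurable XY (borel_enbhd U e').
rewrite !law_unif /law [P (_ @^-1` U)](loebE YB).
rewrite [P (_ @^-1` enbhd U e')](loebE YB') -!EFinD !lee_fin; split.
  have ZU : pr R (Z @^-1` U) - e <= ulim_pr R (fun i => X i @^-1` enbhd U e).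
    apply: ulim_pr_ge; apply: filterS ZX => i /(_ _ bU)[+ _].
    by rewrite !law_unif -EFinD lee_fin lerBlDr.
  have : ulim_pr R (fun i => X i @^-1` enbhd U e) <= ulim_pr R B'.
    apply: le_approx (approx_internal _) YB' _; apply: ae_null_setD.
    apply: filterS XY => w Xw Aw.
    have [i [[u Uu Xu] Xi]] := filter_ex (filterI Aw (cvgr_lt _ Xw _ d0)).
    exists u => //; apply: le_lt_trans (edist_triangle _ (X i (w i)) _) _.
    rewrite edist_sym; lra.
  lra.
have UZ : ulim_pr R (fun i => X i @^-1` enbhd U (e' - e)) <=
    pr R (Z @^-1` enbhd U e') + e.
  apply: ulim_pr_le; apply: filterS ZX => i.
  move=> /(_ _ (borel_enbhd U (e' - e)))[_ +].
  rewrite !law_unif -EFinD lee_fin => /le_trans; apply.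
  rewrite lerD2r; apply: le_pr => x /enbhd_enbhd; apply: sub_enbhd => //.
  by rewrite subrK.
have : ulim_pr R B <= ulim_pr R (fun i => X i @^-1` enbhd U (e' - e)).
  apply: le_approx YB (approx_internal _) _; apply: ae_null_setD.
  apply: filterS XY => w Xw Yw.
  by apply: filterS (cvgr_lt _ Xw _ d0) => i Xi; exists (Y w).
lra.
Qed.

End laws.

(** * The sets [Sk] along the ultraproduct *)

Definition rvec (R : realType) (T : Type) (k : nat) (v v' : 'I_k -> T -> R)
    (x : T) : 'rV[R]_(k + k) :=
  row_mx (\row_j v j x) (\row_j v' j x).

Section Sk_limit.
Variables (R : realType) (N : nat -> nat).
Local Notation Omega := (uprod R N).
Local Notation P := (loebP R N).

Lemma edist_rvec_cvg0 (T : nat -> Type) (T' : Type) k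
    (h h' : forall i, 'I_k -> T i -> R) (v v' : 'I_k -> T' -> R)
    (x : forall i, T i) (w : T') :
  (forall l, (fun i => h i l (x i)) @ nat_ultra --> v l w) ->
  (forall l, (fun i => h' i l (x i)) @ nat_ultra --> v' l w) ->
  (fun i => edist (rvec (h i) (h' i) (x i)) (rvec v v' w)) @ nat_ultra --> (0 : R).
Proof.
move=> hv hv'; apply: edist_cvg0 => j; rewrite /rvec.
case: (split_ordP j) => l ->.
  by rewrite row_mxEl mxE; under eq_fun do rewrite row_mxEl mxE; exact: hv.
by rewrite row_mxEr mxE; under eq_fun do rewrite row_mxEr mxE; exact: hv'.
Qed.

Lemma rvec_lifts k (h h' : forall i, 'I_k -> vert (N i) -> R)
    (v v' : 'I_k -> Omega -> R) :
  (forall l, lifts (fun i => h i l) (v l)) ->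
  (forall l, lifts (fun i => h' i l) (v' l)) ->
  rv_lifts (fun i => rvec (h i) (h' i)) (rvec v v').
Proof.
move=> hv hv'.
have {}hv : \forall w \ae P, forall l,
    (fun i => h i l (w i)) @ nat_ultra --> v l w by exact: filter_forall.
have {}hv' : \forall w \ae P, forall l,
    (fun i => h' i l (w i)) @ nat_ultra --> v' l w by exact: filter_forall.
apply: filterS2 hv hv' => w hw hw'.
exact: (@edist_rvec_cvg0 (fun i => vert (N i)) _ _ h h').
Qed.

Lemma unif_int1 : unif_int (fun i (x : vert (N i)) => 1 : R).
Proof.
move=> e e0; exists 1 => // i; rewrite -[leRHS](avg_cst (N i)).
by apply: ler_avg => x; rewrite minxx subrr ltW.
Qed.

Lemma norm_le1 (x : R) : -1 <= x <= 1 -> `|x| <= 1.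
Proof. by rewrite ler_norml. Qed.

Lemma Sk_unif_unit n (A : (vert n -> R) -> vert n -> R) k :
  unit_family (Sk (unif R n) A (k := k)).
Proof.
split=> [|_ [v _ <-]]; last exact: law_unif_unit.
eexists; exists (fun _ _ => 0); last by [].
by move=> j; split=> // x; rewrite lerN10 ler01.
Qed.

Lemma Sk_loeb_unit (A : (Omega -> R) -> Omega -> R) k :
  unit_family (Sk P A (k := k)).
Proof.
split=> [|_ [v _ <-]]; last exact: law_loeb_unit.
eexists; exists (fun _ _ => 0); last by [].
by move=> j; split=> // x; rewrite lerN10 ler01.
Qed.

Variable a : forall i, vert (N i) -> vert (N i) -> R.
Hypothesis a_ge0 : forall i x y, 0 <= @a i x y.
Hypothesis a_sym : forall i x y, @a i x y = @a i y x.
Hypothesis deg_ui : unif_int (deg a).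

Local Notation S i k := (Sk (unif R (N i)) (@kop R N a i) (k := k)).
Local Notation S_lim k := (Sk P (limop a) (k := k)).

(* For a law in [S_lim k] the close laws in [S i0 k] found for each [j] come from
   vectors [z j] on the finite space [vert (N i0)], so they converge pointwise
   along the ultrafilter. *)
Lemma Sk_limit_le k e i0 : 0 < e ->
  (\forall j \near nat_ultra, dH (S i0 k) (S j k) < e) ->
  dH (S i0 k) (S_lim k) <= 3 * e.
Proof.
move=> e0 dSe.
have dSlt j := dH_lt (Sk_unif_unit (@kop R N a i0) k) (Sk_unif_unit (@kop R N a j) k).
apply: dH_le; [exact: (Sk_unif_unit _ _).1|exact: (Sk_loeb_unit _ _).1| |].
- move=> _ [z z1 <-]; set mu := law _ _.
  have mu' : S i0 k mu by exists z.
  have H j : exists h : 'I_k -> vert (N j) -> R, (forall l x, -1 <= h l x <= 1) /\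
      (dH (S i0 k) (S j k) < e ->
       dLP mu (law (unif R (N j)) (rvec h (fun l => @kop R N a j (h l)))) < e).
    have [/dSlt[/(_ mu mu')[_ [h h1 <-] he] _]|nd] := pselect (dH (S i0 k) (S j k) < e).
      by exists h; split=> // l x; have [_] := h1 l.
    (* The zero vector is a filler for the [j] at which the two sets are not close. *)
    by exists (fun _ _ => 0); split=> // l x; rewrite lerN10 ler01.
  pose h j := projT1 (cid (H j)).
  have h1 j l x : `|h j l x| <= 1.
    by apply: norm_le1; rewrite /h; case: cid => ? [].
  have hd j : dH (S i0 k) (S j k) < e ->
      dLP mu (law (unif R (N j)) (rvec (h j) (fun l => @kop R N a j (h j l)))) < e.
    by rewrite /h; case: cid => ? [].
  have /choice[u hu] : forall l, exists u, lifts (fun j => h j l) u.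
    by move=> l; apply: (dominated_lifts unif_int1).
  (* [Sk] asks for values in [-1, 1] everywhere, while [u] has them only a.e.; the lift [h] is
     unchanged by clipping. *)
  pose v l w := clip 1 (u l w).
  have hv l : lifts (fun j => h j l) (v l).
    have := lifts_comp (clip_lip 1) (hu l).
    by congr lifts; apply: functional_extensionality_dep => i; apply/funext => x; rewrite clip_id.
  have bhv l : bounded_lift (v l) (fun j => h j l) by split=> //; exists 1.
  exists (law P (rvec v (fun l => limop a (v l)))).
    exists v => // l; split; first exact: lifts_measurable (hv l).
    by move=> w; rewrite -ler_norml norm_clip_le.
  apply: dLP_le; first by rewrite mulr_gt0.
  have XY : rv_lifts (fun j => rvec (h j) (fun l => @kop R N a j (h j l)))
      (rvec v (fun l => limop a (v l))).
    by apply: rvec_lifts => // l; exact: limop_lifts.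
  apply: (LPclose_lim XY (e := e)); first lra.
  apply: filterS dSe => j /hd /dLP_lt[||e' /andP[_ /ltW e'e]].
  - exact: law_unif_unit.
  - exact: law_unif_unit.
  exact: LPclose_unif_mono.
- move=> _ [v v1 <-].
  have /choice[h hP] : forall l, exists h : forall j, vert (N j) -> R,
      (forall j x, `|h j x| <= 1) /\ lifts h (v l).
    move=> l; have [mv vl1] := v1 l.
    by apply: lifts_bounded => //; apply: nearW => w; apply: norm_le1.
  pose y j := law (unif R (N j)) (rvec (fun l => h l j) (fun l => @kop R N a j (h l j))).
  have yS j : S j k (y j).
    exists (fun l => h l j) => // l; split=> // x.
    by rewrite -ler_norml; exact: (hP l).1.
  have H j : exists z : 'I_k -> vert (N i0) -> R, (forall l x, -1 <= z l x <= 1) /\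
      (dH (S i0 k) (S j k) < e ->
       dLP (law (unif R (N i0)) (rvec z (fun l => @kop R N a i0 (z l)))) (y j) < e).
    have [/dSlt[_ /(_ _ (yS j))[_ [z z1 <-] ze]]|nd] := pselect (dH (S i0 k) (S j k) < e).
      by exists z; split=> // l x; have [_] := z1 l.
    by exists (fun _ _ => 0); split=> // l x; rewrite lerN10 ler01.
  have {H} /choice[z zP] := H.
  pose z' l x : R := lim ((fun j => z j l x) @ nat_ultra).
  have zz' l x : (fun j => z j l x) @ nat_ultra --> z' l x.
    apply: (@bounded_ultra_cvg _ 1); apply: nearW => j.
    by apply: norm_le1; exact: (zP j).1.
  have z'1 l x : -1 <= z' l x <= 1.
    apply/andP; split; [apply: (cvgr_to_ge (zz' l x))|apply: (cvgr_to_le (zz' l x))];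
      by apply: nearW => j; have /andP[] := (zP j).1 l x.
  exists (law (unif R (N i0)) (rvec z' (fun l => @kop R N a i0 (z' l)))).
    by exists z'.
  apply: dLP_le; first by rewrite mulr_gt0.
  have XY : rv_lifts (fun j => rvec (fun l => h l j) (fun l => @kop R N a j (h l j)))
      (rvec v (fun l => limop a (v l))).
    apply: rvec_lifts => l; first exact: (hP l).2.
    apply: limop_lifts => //; split; last exact: (hP l).2.
    by exists 1 => //; exact: (hP l).1.
  (* One [e] comes from the close laws, the other from replacing [z j] by its limit [z']; the bound
     [3 * e] leaves the slack that [LPclose_lim] needs. *)
  apply: (LPclose_lim XY (e := e + e)); first lra.
  (* There are finitely many vertices, so convergence at each gives closeness at all of them at
     once. *)
  have near_z : \forall j \near nat_ultra, forall x,
      edist (rvec (z j) (fun l => @kop R N a i0 (z j l)) x)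
        (rvec z' (fun l => @kop R N a i0 (z' l)) x) < e.
    apply: filter_forall => x /=; apply: (cvgr_lt _ _ _ e0).
    apply: (@edist_rvec_cvg0 (fun=> vert (N i0)) _ _ z
      (fun j l => @kop R N a i0 (z j l)) _ _ (fun=> x)) => l; first exact: zz'.
    apply: cvg_big => [|y' _]; first exact: add_continuous.
    by apply: cvgMr; exact: zz'.
  apply: filterS2 dSe near_z => j dj zj.
  apply: LPclose_unif_perturb zj _ (ltW e0).
  have /dLP_lt[||e' /andP[_ /ltW e'e]] := (zP j).2 dj.
  - exact: law_unif_unit.
  - exact: law_unif_unit.
  exact: LPclose_unif_mono.
Qed.

End Sk_limit.

(** * Convergence in [dM] *)

(** The first [n] terms have total weight at most 1, and the later ones contribute at most [2^-n],
    as [dH] is at most 1. *)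
Lemma dM_le (R : realType)
    (S1 S2 : forall k : nat, set (set 'rV[R]_(k + k) -> \bar R)) (e : R) n :
  (forall k, unit_family (S1 k)) -> (forall k, unit_family (S2 k)) -> 0 <= e ->
  (forall k, (k < n)%N -> dH (S1 k.+1) (S2 k.+1) <= e) ->
  0 <= dM S1 S2 <= e + 2 ^- n.
Proof.
move=> S1u S2u e0 dSe; rewrite /dM; set u := (fun k => _).
have d01 k : 0 <= dH (S1 k.+1) (S2 k.+1) <= 1 by exact: dH_bounds.
have uE m : series u m = \sum_(k < m) 2 ^- k.+1 * dH (S1 k.+1) (S2 k.+1).
  by rewrite /series/= big_mkord.
have p0 k : 0 <= (2 : R) ^- k by rewrite invr_ge0 exprn_ge0.
have u_ge0 k : 0 <= u k by rewrite mulr_ge0//; have /andP[] := d01 k.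
have cvg_u : cvgn (series u).
  apply: nondecreasing_is_cvgn.
    by apply: nondecreasing_series => k _ _; exact: u_ge0.
  exists 1 => _ [m _ <-]; rewrite uE.
  have /andP[_] := dyadic_tail d01 (leq0n m).
  by rewrite big_ord0 add0r expr0 invr1 => /le_trans; apply; rewrite gerBl.
apply/andP; split.
  apply: limr_ge => //; apply: nearW => m; rewrite uE.
  by apply: sumr_ge0 => k _; exact: u_ge0.
apply: limr_le => //; exists n => // m /= nm; rewrite uE.
have /andP[_ h] := dyadic_tail d01 nm; apply: le_trans h _; apply: lerD.
  apply: (@le_trans _ _ (\sum_(k < n) 2 ^- k.+1 * e)).
    by apply: ler_sum => k _; rewrite ler_wpM2l// dSe.
  by rewrite -mulr_suml sum_dyad ler_piMl// gerBl.
by rewrite gerBl.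
Qed.

Lemma dM_cvg0 (R : realType)
    (S : nat -> forall k : nat, set (set 'rV[R]_(k + k) -> \bar R))
    (S' : forall k : nat, set (set 'rV[R]_(k + k) -> \bar R)) :
  (forall i k, unit_family (S i k)) -> (forall k, unit_family (S' k)) ->
  (forall k e, (0 < k)%N -> 0 < e ->
    exists m, forall i, (m <= i)%N -> dH (S i k) (S' k) <= e) ->
  (fun i => dM (S i) S') @ \oo --> (0 : R).
Proof.
move=> Su S'u dS; apply/cvgr0Pnorm_le => e e0.
have e20 : 0 < e / 2 by rewrite divr_gt0.
have [n ne] := exists_dyad_lt e20.
have /choice[m mP] : forall k, exists m, forall i, (m <= i)%N ->
    dH (S i k.+1) (S' k.+1) <= e / 2 by move=> k; exact: dS.
exists (\max_(k < n) m k) => // i /= mi.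
have /andP[d0 de] : 0 <= dM (S i) S' <= e / 2 + 2 ^- n.
  apply: dM_le => //; first exact: ltW.
  move=> k kn; apply: mP; apply: leq_trans mi.
  exact: (leq_bigmax (Ordinal kn)).
by rewrite ger0_norm//; lra.
Qed.

(** * Uniform integrability from a moment bound, and the theorem *)

(** Above [K = B^(1/(q-1))] one has [y^(q-1) >= B], hence [y <= y^q / B]; up to [K] the left side is
    0. *)
Lemma powR_tail (R : realType) (q B : R) : 1 < q -> 0 < B ->
  exists2 K : R, 0 < K & forall y, 0 <= y -> y - Num.min y K <= B^-1 * y `^ q.
Proof.
move=> q1 B0; have q10 : q - 1 != 0 by rewrite subr_eq0 gt_eqF.
exists (B `^ (q - 1)^-1) => [|y y0]; first exact: powR_gt0.
have yq0 : 0 <= B^-1 * y `^ q by rewrite mulr_ge0 ?powR_ge0// invr_ge0 ltW.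
have [yK|Ky] := leP y; first by rewrite subrr.
have y_gt0 : 0 < y by apply: lt_trans Ky; exact: powR_gt0.
apply: (@le_trans _ _ y); first by rewrite gerBl powR_ge0.
have By : B <= y `^ (q - 1).
  have -> : B = (B `^ (q - 1)^-1) `^ (q - 1).
    by rewrite -powRrM mulVf// powRr1// ltW.
  by rewrite ge0_ler_powR ?nnegrE ?powR_ge0 ?subr_ge0 ?ltW.
have -> : y `^ q = y `^ (q - 1) * y.
  rewrite -[X in _ = _ * X]powRr1// -powRD; last by rewrite (gt_eqF y_gt0) implybT.
  by rewrite subrK.
by rewrite mulrA ler_peMl// mulrC ler_pdivlMr// mul1r.
Qed.

Lemma avg_powR_le (R : realType) n (g : vert n -> R) (q c : R) :
  0 < q -> 0 <= c -> (forall x, 0 <= g x) ->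
  (Lnorm (unif R n) q%:E (EFin \o g) <= c%:E)%E ->
  avg (fun x => g x `^ q) <= c `^ q.
Proof.
move=> q0 c0 g0; rewrite unlock.
under eq_integral do rewrite /= ger0_norm//.
rewrite integral_unif; last by move=> x; exact: powR_ge0.
set B := avg _; rewrite poweR_EFin lee_fin => Bc.
have B0 : 0 <= B by apply: avg_ge0 => x; exact: powR_ge0.
have -> : B = (B `^ q^-1) `^ q by rewrite -powRrM mulVf ?gt_eqF// powRr1.
by apply: ge0_ler_powR; rewrite ?nnegrE ?powR_ge0 ?(ltW q0).
Qed.

Theorem theorem5p2 (R : realType)
  (f : forall n' : nat, sgraph n' -> R)
  (f_pos : forall (n' : nat) (G : sgraph n'), 0 < f n' G)
  (f_inv : forall (n' : nat) (G G' : sgraph n'), gisom G G' -> f n' G = f n' G')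
  (N : nat -> nat) (G : forall i : nat, sgraph (N i))
  (Hconv : action_convergent
     (fun i => Sk (unif R (N i)) (fun v x => graph_op (G i) v x / f (N i) (G i))))
  (p q c : R) (hp : 1 <= p) (hq : 1 < q) (hc : 0 < c)
  (Hbound : forall i : nat,
     pq_norm_le (unif R (N i)) (fun v x => graph_op (G i) v x / f (N i) (G i))
       p%:E q%:E c%:E) :
  exists (d : measure_display) (T : measurableType d) (P : probability T R)
         (A : (T -> R) -> (T -> R)),
    graphop P A /\
    (fun i => dM (Sk (unif R (N i)) (fun v x => graph_op (G i) v x / f (N i) (G i)))
                 (Sk P A)) @ \oo --> 0.
Proof.
pose a i (x y : vert (N i)) : R := (adj (G i) y x)%:R / f (N i) (G i).
have opE i : (fun v x => graph_op (G i) v x / f (N i) (G i)) = @kop R N a i.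
  apply/funext => v; apply/funext => x.
  rewrite /graph_op /kop mulr_suml big_mkcond; apply: eq_bigr => y _.
  case: ifP => xy; rewrite /a (xy : adj (G i) y x = _) ?mul0r//.
  by rewrite mulr1n div1r mulrC.
have a_ge0 i x y : 0 <= a i x y by rewrite divr_ge0// ltW.
have a_sym i x y : a i x y = a i y x by rewrite /a adj_sym.
(* The operator bound at the constant 1, whose [p]-norm is 1, bounds the [q]-norm of the degrees by
   [c]. The choice [B = c^q / e] in [powR_tail] then makes the tail at most [e]. *)
have deg_ui : unif_int (deg a).
  move=> e e0; have cq0 : 0 < c `^ q / e by rewrite divr_gt0// powR_gt0.
  have [K K0 KP] := powR_tail hq cq0.
  exists K => // i.
  have degq : avg (fun x => deg a (i := i) x `^ q) <= c `^ q.
    apply: avg_powR_le; [exact: lt_trans hq|exact: ltW|exact: deg_ge0|].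
    have L1 : Linf (unif R (N i)) (cst 1).
      by split=> //; exists 1; apply: nearW => x; rewrite normr1.
    have := Hbound i; rewrite opE => /(_ (cst 1) L1).
    have -> : @kop R N a i (cst 1) = deg a (i := i).
      by apply/funext => x; apply: eq_bigr => y _; rewrite mulr1.
    have -> : EFin \o cst 1 = cst 1%E :> (vert (N i) -> \bar R) by [].
    by rewrite Lnorm_cst1 [X in (X `^ _)%E]probability_setT poweR1r mule1.
  apply: (@le_trans _ _ ((c `^ q / e)^-1 * avg (fun x => deg a (i := i) x `^ q))).
    by rewrite -avgZ; apply: ler_avg => x; apply: KP; exact: deg_ge0.
  rewrite ler_pdivrMl//; apply: le_trans degq _.
  by rewrite divfK// gt_eqF.
exists default_measure_display, (uprod R N), (loebP R N), (limop a).
split; first exact: limop_graphop.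
apply: dM_cvg0 => [i k|k|k e k0 e0].
- exact: Sk_unif_unit.
- exact: Sk_loeb_unit.
have e30 : 0 < e / 3 by rewrite divr_gt0.
have [m mP] := Hconv k k0 _ e30; exists m => i mi.
(* With [i >= m] fixed, the Cauchy condition holds for all [j >= m], hence for most [j]. So the
   whole sequence converges, although the limit was built along an ultrafilter. *)
have := @Sk_limit_le _ _ _ a_ge0 a_sym deg_ui k _ i e30.
rewrite (_ : 3 * (e / 3) = e); last by field.
rewrite opE; apply; apply: filterS (near_ultra_ge m) => j mj.
by have := mP i j mi mj; rewrite !opE.
Qed.
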